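(* Assume the OMv3 hypothesis. Then any algorithm with polynomial preprocessing time computing incremental {\rm nw-stSP}, and likewise decremental {\rm nw-stSP}, on $n$-node undirected graphs requires $n^{\omega+1-o(1)}$ total update and query time.
   Context: {\rm nw-stSP}: given a graph with nonnegative node weights and fixed nodes $s,t$, maintain the minimum over $s$–$t$ paths of the sum of node weights on the path; incremental means only edge insertions, decremental only edge deletions. $\omega$ is the square matrix multiplication exponent. OMv3 problem: preprocess an $n\times n$ Boolean matrix $A$; then $n$ queries arrive online, each consisting of three Boolean vectors $u,v,w\in\{0,1\}^n$, and one must output $\bigvee_{i,j,k}(u_i\wedge v_j\wedge w_k\wedge A_{ij}\wedge A_{jk}\wedge A_{ki})$ before the next query arrives. OMv3 hypothesis: there is no algorithm with polynomial preprocessing time and total query time $O(n^{\omega+1-\varepsilon})$ for the OMv3 problem, for any $\varepsilon>0$. *)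

(* Defs.v *)
From mathcomp Require Import all_boot all_order all_algebra.
From mathcomp Require Import all_classical all_reals all_analysis.

Set Implicit Arguments.
Unset Strict Implicit.
Unset Printing Implicit Defensive.

Import Order.TTheory GRing.Theory Num.Theory.

Local Open Scope classical_set_scope.
Local Open Scope nat_scope.

(* Matrix multiplication exponent.  Matrices over the rationals are multiplied
   by division-free straight-line programs.  Wire [i] of a program is its
   [i]-th input, or, past the inputs, the result of an earlier instruction. *)

Inductive slp_instr : Type :=
| SCst of rat
| SAdd of nat & nat
| SSub of nat & nat
| SMul of nat & nat.

Definition slp_step (vals : seq rat) (g : slp_instr) : seq rat :=
  let val i := nth 0%R vals i in
  rcons vals match g with
             | SCst a => a
             | SAdd i j => (val i + val j)%R
             | SSub i j => (val i - val j)%R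
             | SMul i j => (val i * val j)%R
             end.

Definition slp_eval (inputs : seq rat) (p : seq slp_instr) : seq rat :=
  foldl slp_step inputs p.

Definition mx_entries (n : nat) (A : 'M[rat]_n) : seq rat :=
  codom (fun k => mxvec A ord0 k).

Definition multiplies_matrices (n : nat) (p : seq slp_instr) : Prop :=
  exists out : 'I_n -> 'I_n -> nat, forall (A B : 'M[rat]_n) (i j : 'I_n),
    nth 0%R (slp_eval (mx_entries A ++ mx_entries B) p) (out i j)
      = (A *m B)%R i j.

Definition omega (R : realType) : R :=
  inf [set x : R | exists C : R, forall n : nat, 0 < n ->
    exists2 p, multiplies_matrices n p &
               ((size p)%:R <= C * n%:R `^ x)%R].

(* Word RAM.  A program mentions finitely many registers and arrays, named by
   natural numbers; arrays have no fixed length, and contents are [w]-bit words.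
   A step that would produce a value not fitting in a word has no transition,
   so it never belongs to a successful execution. *)

Record state : Type := State {
  reg : nat -> nat;
  arr : nat -> nat -> nat
}.

Definition zero_state : state := State (fun _ => 0) (fun _ _ => 0).

Definition override (T : Type) (f : nat -> T) (i : nat) (v : T) : nat -> T :=
  fun j => if j == i then v else f j.

Definition set_reg (r v : nat) (st : state) : state :=
  State (override (reg st) r v) (arr st).

Definition set_cell (a i v : nat) (st : state) : state :=
  State (reg st) (override (arr st) a (override (arr st a) i v)).

Inductive word_op : Type :=
| WAdd | WSub | WMul | WDiv | WMod | WAnd | WOr | WXor | WShl | WShr
| WEq | WLt.

Definition eval_op (o : word_op) (x y : nat) : nat :=
  match o with
  | WAdd => x + y
  | WSub => x - y
  | WMul => x * y
  | WDiv => x %/ y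
  | WMod => x %% y
  | WAnd => Nat.land x y
  | WOr => Nat.lor x y
  | WXor => Nat.lxor x y
  | WShl => Nat.shiftl x y
  | WShr => Nat.shiftr x y
  | WEq => x == y
  | WLt => x < y
  end.

Inductive com : Type :=
| Skip
| Const of nat & nat                  (* reg r := k *)
| Op of nat & word_op & nat & nat     (* reg r := reg r1 o reg r2 *)
| Read of nat & nat & nat             (* reg r := arr a (reg i) *)
| Write of nat & nat & nat            (* arr a (reg i) := reg r *)
| Seq of com & com
| If of nat & com & com
| While of nat & com.

(* [exec w c st k st']: with words of [w] bits, [c] started in [st] halts in
   [st'] after [k] unit-cost steps. *)
Inductive exec (w : nat) : com -> state -> nat -> state -> Prop :=
| ExecSkip st :
    exec w Skip st 1 st
| ExecConst r k st :
    k < 2 ^ w ->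
    exec w (Const r k) st 1 (set_reg r k st)
| ExecOp r o r1 r2 st :
    eval_op o (reg st r1) (reg st r2) < 2 ^ w ->
    exec w (Op r o r1 r2) st 1
         (set_reg r (eval_op o (reg st r1) (reg st r2)) st)
| ExecRead r a i st :
    arr st a (reg st i) < 2 ^ w ->
    exec w (Read r a i) st 1 (set_reg r (arr st a (reg st i)) st)
| ExecWrite a i r st :
    reg st r < 2 ^ w ->
    exec w (Write a i r) st 1 (set_cell a (reg st i) (reg st r) st)
| ExecSeq c1 c2 st st1 st2 k1 k2 :
    exec w c1 st k1 st1 -> exec w c2 st1 k2 st2 ->
    exec w (Seq c1 c2) st (k1 + k2) st2
| ExecIfTrue r c1 c2 st st' k :
    reg st r != 0 -> exec w c1 st k st' ->
    exec w (If r c1 c2) st k.+1 st'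
| ExecIfFalse r c1 c2 st st' k :
    reg st r = 0 -> exec w c2 st k st' ->
    exec w (If r c1 c2) st k.+1 st'
| ExecWhileFalse r c st :
    reg st r = 0 ->
    exec w (While r c) st 1 st
| ExecWhileTrue r c st st1 st2 k1 k2 :
    reg st r != 0 -> exec w c st k1 st1 -> exec w (While r c) st1 k2 st2 ->
    exec w (While r c) st (k1 + k2).+1 st2.

(* [c] times the bit length of [n], i.e. words of O(log n) bits. *)
Definition word_size (c n : nat) : nat := c * (trunc_log 2 n).+1.

(* Inputs are handed over by overwriting the first cells of input arrays. *)
Definition put_vec (a n : nat) (f : 'I_n -> nat) (st : state) : state :=
  State (reg st)
    (override (arr st) a
       (fun i => if insub i is Some i' then f i' else arr st a i)).

(* Row-major layout. *)
Definition put_mx (a n : nat) (f : 'I_n -> 'I_n -> nat) (st : state) : state :=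
  State (reg st)
    (override (arr st) a
       (fun i => match insub (i %/ n), insub (i %% n) with
                 | Some x, Some y => f x y
                 | _, _ => arr st a i
                 end)).

(* OMv3. *)

Definition omv3_query (n : nat) : Type :=
  ('rV[bool]_n * 'rV[bool]_n * 'rV[bool]_n)%type.

Definition omv3_answer (n : nat) (A : 'M[bool]_n) (q : omv3_query n) : bool :=
  let: (u, v, w) := q in
  [exists i, exists j, exists k,
     [&& u ord0 i, v ord0 j, w ord0 k, A i j, A j k & A k i]].

Definition omv3_init (n : nat) (A : 'M[bool]_n) : state :=
  put_mx 0 (fun i j => A i j : nat) (set_reg 0 n zero_state).

Definition omv3_put_query (n : nat) (q : omv3_query n) (st : state) : state :=
  let: (u, v, w) := q in
  put_vec 1 (fun i => u ord0 i : nat)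
    (put_vec 2 (fun i => v ord0 i : nat)
       (put_vec 3 (fun i => w ord0 i : nat) st)).

(* From state [st], the queries [qs] are answered one after the other, each
   answer being left in register 0, in total time [k]. *)
Fixpoint omv3_serves (w n : nat) (A : 'M[bool]_n) (qry : com) (st : state)
    (qs : seq (omv3_query n)) (k : nat) : Prop :=
  match qs with
  | [::] => k = 0
  | q :: qs' => exists k1 st1 k2,
      [/\ exec w qry (omv3_put_query q st) k1 st1,
          reg st1 0 = omv3_answer A q,
          omv3_serves w A qry st1 qs' k2
        & k = k1 + k2]
  end.

(* The algorithm (prep, qry) solves OMv3 with polynomial preprocessing time and
   total query time at most [T]. *)
Definition solves_omv3 (R : realType) (prep qry : com) (T : nat -> R) : Prop :=
  exists c a b : nat, forall n : nat, 0 < n ->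
  forall (A : 'M[bool]_n) (qs : seq (omv3_query n)), size qs = n ->
  exists k0 st0 k,
    [/\ exec (word_size c n) prep (omv3_init A) k0 st0,
        k0 <= a * n ^ b,
        omv3_serves (word_size c n) A qry st0 qs k
      & (k%:R <= T n)%R].

Definition OMv3_hypothesis (R : realType) : Prop :=
  forall eps : R, (0 < eps)%R ->
  ~ exists (prep qry : com) (C : R),
      solves_omv3 prep qry (fun n => (C * n%:R `^ (omega R + 1 - eps))%R).

(* Dynamic nw-stSP. *)

Inductive dyn_mode : Type := Incremental | Decremental.

Inductive dyn_op (n : nat) : Type :=
| Update of 'I_n & 'I_n
| Query.
Arguments Query {n}.

Definition is_query (n : nat) (o : dyn_op n) : bool :=
  if o is Query then true else false.

Definition is_graph (n : nat) (e : rel 'I_n) : Prop :=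
  symmetric e /\ irreflexive e.

Definition same_edge (n : nat) (x y a b : 'I_n) : bool :=
  ((a == x) && (b == y)) || ((a == y) && (b == x)).

Definition update_graph (m : dyn_mode) (n : nat) (e : rel 'I_n) (x y : 'I_n) :
    rel 'I_n :=
  match m with
  | Incremental => fun a b => e a b || same_edge x y a b
  | Decremental => fun a b => e a b && ~~ same_edge x y a b
  end.

Definition legal_update (m : dyn_mode) (n : nat) (e : rel 'I_n) (x y : 'I_n) :
    bool :=
  match m with
  | Incremental => (x != y) && ~~ e x y
  | Decremental => e x y
  end.

Fixpoint legal_ops (m : dyn_mode) (n : nat) (e : rel 'I_n)
    (ops : seq (dyn_op n)) : bool :=
  match ops with
  | [::] => true
  | Update x y :: ops' =>
      legal_update m e x y && legal_ops m (update_graph m e x y) ops'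
  | Query :: ops' => legal_ops m e ops'
  end.

(* No more queries than graph versions; with an unbounded number of queries the
   total query time would be unbounded for trivial reasons. *)
Definition few_queries (n : nat) (ops : seq (dyn_op n)) : bool :=
  count (@is_query n) ops <= (count (predC (@is_query n)) ops).+1.

Definition st_path (n : nat) (e : rel 'I_n) (s t : 'I_n) (p : seq 'I_n) : bool :=
  [&& path e s p, last s p == t & uniq (s :: p)].

Definition path_weight (n : nat) (wt : 'I_n -> nat) (s : 'I_n) (p : seq 'I_n) :
    nat :=
  \sum_(x <- s :: p) wt x.

(* Register 0 tells whether [t] is reachable, register 1 is the distance. *)
Definition nwstSP_output (n : nat) (e : rel 'I_n) (wt : 'I_n -> nat)
    (s t : 'I_n) (st : state) : Prop :=
  (reg st 0 = 0 /\ forall p, ~~ st_path e s t p) \/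
  [/\ reg st 0 = 1,
      exists2 p, st_path e s t p & path_weight wt s p = reg st 1
    & forall p, st_path e s t p -> reg st 1 <= path_weight wt s p].

Definition nwstSP_init (n : nat) (e : rel 'I_n) (wt : 'I_n -> nat)
    (s t : 'I_n) : state :=
  put_mx 0 (fun x y => e x y : nat)
    (put_vec 1 wt
       (set_reg 0 n (set_reg 1 s (set_reg 2 t zero_state)))).

Definition put_edge (n : nat) (x y : 'I_n) (st : state) : state :=
  set_reg 0 x (set_reg 1 y st).

Fixpoint nwstSP_serves (m : dyn_mode) (w n : nat) (wt : 'I_n -> nat)
    (s t : 'I_n) (upd qry : com) (e : rel 'I_n) (st : state)
    (ops : seq (dyn_op n)) (k : nat) : Prop :=
  match ops with
  | [::] => k = 0
  | Update x y :: ops' => exists k1 st1 k2,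
      [/\ exec w upd (put_edge x y st) k1 st1,
          nwstSP_serves m w wt s t upd qry (update_graph m e x y) st1 ops' k2
        & k = k1 + k2]
  | Query :: ops' => exists k1 st1 k2,
      [/\ exec w qry st k1 st1,
          nwstSP_output e wt s t st1,
          nwstSP_serves m w wt s t upd qry e st1 ops' k2
        & k = k1 + k2]
  end.

(* The algorithm (prep, upd, qry) solves dynamic nw-stSP on n-node graphs with
   integer weights at most n ^ d, with polynomial preprocessing time and total
   update and query time at most [T]. *)
Definition solves_nwstSP (R : realType) (m : dyn_mode) (prep upd qry : com)
    (d : nat) (T : nat -> R) : Prop :=
  exists c a b : nat, forall n : nat, 0 < n ->
  forall (e : rel 'I_n) (wt : 'I_n -> nat) (s t : 'I_n)
         (ops : seq (dyn_op n)),
    is_graph e -> (forall x, wt x <= n ^ d) ->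
    legal_ops m e ops -> few_queries ops ->
  exists k0 st0 k,
    [/\ exec (word_size c n) prep (nwstSP_init e wt s t) k0 st0,
        k0 <= a * n ^ b,
        nwstSP_serves m (word_size c n) wt s t upd qry e st0 ops k
      & (k%:R <= T n)%R].

(* Total time n ^ (x - o(1)) is necessary: time O(n ^ (x - eps)) is out of reach
   for every eps > 0.  The weights of an instance family are bounded by a
   polynomial of arbitrary degree [d], on which hidden constants may depend. *)
Definition nwstSP_requires (R : realType) (m : dyn_mode) (x : R) : Prop :=
  forall eps : R, (0 < eps)%R ->
  ~ exists prep upd qry : com, forall d : nat, exists C : R,
      solves_nwstSP m prep upd qry d (fun n => (C * n%:R `^ (x - eps))%R).

(* Main.v *)
Require Import Defs.
From mathcomp Require Import all_boot all_order all_algebra.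
From mathcomp Require Import all_classical all_reals all_analysis.
From mathcomp Require Import zify.

(* An OMv3 instance A with n queries (u, v, w) is simulated on a graph whose
   24 n nodes are arranged in twelve layers

     s - H - I - X - Y - Z - X' - Y' - Z' - I' - H' - t.

   The edges I - X, Z - X' and Z' - I' are those of A.  The edges X - Y - Z
   keep the identity of a vertex j while filtering by v: in the phase with label
   q the edges X_j - Y_(j+q) - Z_j are handled, and the node weights n - j,
   2 (j + q), n - j make every such detour cost 2 n plus the two labels used, so
   that a path using label q on both sides also returns to the same j.  The part
   X' - Y' - Z' does the same for w.  The ends H - I and I' - H' have weights
   n q and i, and the pairs (q, i) are handled one by one in lexicographic
   order, so that a lightest path closes the walk at the same i.  Hence, right
   when (q, i) is handled, the distance reaches its least conceivable value iff
   some triangle goes through i.  Insertions run through the labels downwards,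
   adding the selected edges; deletions run upwards, removing what is not
   selected and, later, everything of the finished label: in both cases the
   present edges have labels at least the current one.

   There are O(n^2) updates and queries; since a run with n^2 operations takes
   at least n^2 steps, the O(n^2) overhead is absorbed by the time bound without
   any information on omega. *)

Local Open Scope nat_scope.

(** * Programs hosting other programs *)

(** The word size enters only through the overflow conditions. The hosted algorithm is given for
    words fitted to [24 * n] nodes, while the simulation runs on wider ones. *)
Lemma exec_widen w w' c st k st' :
  w <= w' -> exec w c st k st' -> exec w' c st k st'.
Proof.
move=> le_ww'; have fit v : v < 2 ^ w -> v < 2 ^ w'.
  by move=> /leq_trans; apply; rewrite leq_exp2l.
elim; by [constructor | move=> *; constructor; auto
  | move=> *; econstructor; eauto].
Qed.

Lemma exec_pos w c st k st' : exec w c st k st' -> 0 < k.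
Proof. by elim=> // *; lia. Qed.

(* The hosted program owns the registers and arrays from 32 on; registers 8
   to 31 are scratch space for evaluating expressions. *)
Fixpoint hosted (c : com) : com :=
  match c with
  | Skip => Skip
  | Const r k => Const (32 + r) k
  | Op r o r1 r2 => Op (32 + r) o (32 + r1) (32 + r2)
  | Read r a i => Read (32 + r) (32 + a) (32 + i)
  | Write a i r => Write (32 + a) (32 + i) (32 + r)
  | Seq c1 c2 => Seq (hosted c1) (hosted c2)
  | If r c1 c2 => If (32 + r) (hosted c1) (hosted c2)
  | While r c => While (32 + r) (hosted c)
  end.

Definition hosts (St emb : state) : Prop :=
  (forall r, reg St (32 + r) = reg emb r) /\
  (forall a, arr St (32 + a) =1 arr emb a).

Definition same_own (St St' : state) : Prop :=
  (forall r, r < 32 -> reg St' r = reg St r) /\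
  (forall a, a < 32 -> arr St' a =1 arr St a).

Lemma same_own_trans St1 St2 St3 :
  same_own St1 St2 -> same_own St2 St3 -> same_own St1 St3.
Proof.
move=> [r12 a12] [r23 a23]; split=> [r lt_r|a lt_a i].
  by rewrite r23 // r12.
by rewrite a23 // a12.
Qed.

Lemma hosts_set_reg St emb r v :
  hosts St emb -> hosts (set_reg (32 + r) v St) (set_reg r v emb).
Proof.
move=> [hr ha]; split=> //= r'.
by rewrite /override eqn_add2l; case: eqP.
Qed.

Lemma same_own_set_reg St r v : same_own St (set_reg (32 + r) v St).
Proof.
split=> //= r' lt_r'; rewrite /override; case: eqP => // E; lia.
Qed.

Lemma hosts_set_cell St emb a i v :
  hosts St emb -> hosts (set_cell (32 + a) i v St) (set_cell a i v emb).
Proof.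
move=> [hr ha]; split=> //= a' j.
rewrite /override eqn_add2l; case: eqP => _; last exact: ha.
by rewrite /override; case: eqP => // _; exact: ha.
Qed.

Lemma same_own_set_cell St a i v : same_own St (set_cell (32 + a) i v St).
Proof.
split=> //= a' lt_a' j; rewrite /override; case: eqP => // E; lia.
Qed.

(** Shifting all registers and arrays by 32 is a mere renaming, so the step count is kept exactly
    and the simulator's own memory is untouched. *)
Lemma exec_hosted w c emb k emb' : exec w c emb k emb' ->
  forall St, hosts St emb -> exists St',
    [/\ exec w (hosted c) St k St', hosts St' emb' & same_own St St'].
Proof.
elim=> {c emb k emb'}.
- by move=> emb St h; exists St; split=> //; constructor.
- move=> r k emb lt_k St h; exists (set_reg (32 + r) k St).
  split; [exact: ExecConst | exact: hosts_set_reg | exact: same_own_set_reg].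
- move=> r o r1 r2 emb lt_v St h.
  rewrite -!(proj1 h) in lt_v *.
  eexists; split; [exact: ExecOp | exact: hosts_set_reg
    | exact: same_own_set_reg].
- move=> r a i emb lt_v St h.
  rewrite -(proj2 h) -(proj1 h) in lt_v *.
  eexists; split; [exact: ExecRead | exact: hosts_set_reg
    | exact: same_own_set_reg].
- move=> a i r emb lt_v St h.
  rewrite -!(proj1 h) in lt_v *.
  eexists; split; [exact: ExecWrite | exact: hosts_set_cell
    | exact: same_own_set_cell].
- move=> c1 c2 emb emb1 emb2 k1 k2 _ IH1 _ IH2 St /IH1[St1 [e1 h1 s1]].
  have [St2 [e2 h2 s2]] := IH2 _ h1.
  exists St2; split=> //; first exact: ExecSeq e1 e2.
  exact: same_own_trans s1 s2.
- move=> r c1 c2 emb emb' k nz _ IH St h.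
  have [St1 [e1 h1 s1]] := IH _ h.
  by exists St1; split=> //=; apply: ExecIfTrue; rewrite // (proj1 h).
- move=> r c1 c2 emb emb' k nz _ IH St h.
  have [St1 [e1 h1 s1]] := IH _ h.
  by exists St1; split=> //=; apply: ExecIfFalse; rewrite // (proj1 h).
- move=> r c emb z St h; exists St; split=> //=.
  by apply: ExecWhileFalse; rewrite (proj1 h).
- move=> r c emb emb1 emb2 k1 k2 nz _ IH1 _ IH2 St h.
  have [St1 [e1 h1 s1]] := IH1 _ h.
  have [St2 [e2 h2 s2]] := IH2 _ h1.
  exists St2; split=> //=; last exact: same_own_trans s1 s2.
  by apply: ExecWhileTrue e1 e2; rewrite (proj1 h).
Qed.

(** * Expressions and their compilation *)

Inductive expr : Type :=
| EC of nat
| ER of nat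
| EO of word_op & expr & expr
| EA of nat & expr.

Fixpoint expr_val (own : state) (e : expr) : nat :=
  match e with
  | EC k => k
  | ER r => reg own r
  | EO o e1 e2 => eval_op o (expr_val own e1) (expr_val own e2)
  | EA a e => arr own a (expr_val own e)
  end.

(** The scratch registers from [d] upwards form an evaluation stack. A register is copied by taking
    its bitwise or with itself. *)
Fixpoint compile (e : expr) (d : nat) : com :=
  match e with
  | EC k => Const d k
  | ER r => Op d WOr r r
  | EO o e1 e2 =>
      Seq (compile e1 d) (Seq (compile e2 d.+1) (Op d o d d.+1))
  | EA a e => Seq (compile e d) (Read d a d)
  end.

Fixpoint cost (e : expr) : nat :=
  match e with
  | EC _ | ER _ => 1
  | EO _ e1 e2 => cost e1 + (cost e2 + 1)
  | EA _ e => cost e + 1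
  end.

Fixpoint height (e : expr) : nat :=
  match e with
  | EC _ | ER _ => 1
  | EO _ e1 e2 => maxn (height e1) (height e2).+1
  | EA _ e => height e
  end.

(** These are the operations whose results [degree] controls; subtraction, division, remainder and
    bitwise and never exceed their first operand. *)
Definition bounded_op (o : word_op) : bool :=
  match o with WOr | WXor | WShl | WShr => false | _ => true end.

Fixpoint wf_expr (e : expr) : bool :=
  match e with
  | EC _ => true
  | ER r => r < 8
  | EO o e1 e2 => [&& bounded_op o, wf_expr e1 & wf_expr e2]
  | EA a e => (a < 32) && wf_expr e
  end.

Fixpoint fits (w : nat) (own : state) (e : expr) : bool :=
  (expr_val own e < 2 ^ w) &&
  match e with
  | EC _ | ER _ => true
  | EO _ e1 e2 => fits w own e1 && fits w own e2
  | EA _ e => fits w own e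
  end.

Fixpoint vars (e : expr) : seq nat :=
  match e with
  | EC _ => [::]
  | ER r => [:: r]
  | EO _ e1 e2 => vars e1 ++ vars e2
  | EA _ e => vars e
  end.

(* Values are measured by exponents: [degree e] bounds the value of [e] by a
   power of [b] when the registers stay below [b ^ 20] and the arrays hold
   bits. *)
Fixpoint degree (e : expr) : nat :=
  match e with
  | EC k => k
  | ER _ => 20
  | EO o e1 e2 =>
      match o with
      | WAdd => (maxn (degree e1) (degree e2)).+1
      | WMul => degree e1 + degree e2
      | WEq | WLt => 1
      | _ => degree e1
      end
  | EA _ _ => 1
  end.

Fixpoint max_degree (e : expr) : nat :=
  maxn (degree e)
  match e with
  | EC _ | ER _ => 0
  | EO _ e1 e2 => maxn (max_degree e1) (max_degree e2)
  | EA _ e => max_degree e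
  end.

Lemma land_le x y : Nat.land x y <= x.
Proof. by have := PeanoNat.Nat.land_le_l x y; lia. Qed.

(** A sum costs one more power of [b] because [2 <= b], the exponents of a product add up, and a
    constant satisfies [k < b ^ k]. *)
Lemma eval_degree b own e : 1 < b -> wf_expr e ->
  all (fun r => reg own r < b ^ 20) (vars e) ->
  (forall a i, arr own a i <= 1) ->
  expr_val own e < b ^ degree e.
Proof.
move=> b_gt1 + + bits; elim: e => [k|r|o e1 IH1 e2 IH2|a e _].
- by move=> _ _ /=; exact: ltn_expl.
- by move=> _ /=; rewrite andbT.
- move=> /= /and3P[bo wf1 wf2]; rewrite all_cat => /andP[v1 v2].
  have {v1}IH1 := IH1 wf1 v1; have {v2}IH2 := IH2 wf2 v2.
  have sum : expr_val own e1 + expr_val own e2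
             < b ^ (maxn (degree e1) (degree e2)).+1.
    have le_l : b ^ degree e1 <= b ^ maxn (degree e1) (degree e2).
      by rewrite leq_exp2l // leq_maxl.
    have le_r : b ^ degree e2 <= b ^ maxn (degree e1) (degree e2).
      by rewrite leq_exp2l // leq_maxr.
    rewrite expnS; apply: (@leq_trans (2 * b ^ maxn (degree e1) (degree e2))).
      move: (b ^ maxn _ _) le_l le_r => M le_l le_r.
      by move: (leq_trans IH1 le_l) (leq_trans IH2 le_r); lia.
    by rewrite leq_mul2r b_gt1 orbT.
  case: o bo => //= _.
  + exact: leq_ltn_trans (leq_subr _ _) IH1.
  + by rewrite expnD; apply: ltn_mul.
  + exact: leq_ltn_trans (leq_div _ _) IH1.
  + exact: leq_ltn_trans (leq_mod _ _) IH1.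
  + exact: leq_ltn_trans (land_le _ _) IH1.
  + by rewrite expn1; exact: leq_ltn_trans (leq_b1 _) b_gt1.
  + by rewrite expn1; exact: leq_ltn_trans (leq_b1 _) b_gt1.
- by move=> _ _ /=; rewrite expn1; exact: leq_ltn_trans (bits _ _) b_gt1.
Qed.

Lemma fits_degree w b own e : 1 < b -> b ^ max_degree e <= 2 ^ w ->
  wf_expr e -> all (fun r => reg own r < b ^ 20) (vars e) ->
  (forall a i, arr own a i <= 1) ->
  fits w own e.
Proof.
move=> b_gt1 + + + bits.
have top e' : b ^ max_degree e' <= 2 ^ w -> wf_expr e' ->
    all (fun r => reg own r < b ^ 20) (vars e') -> expr_val own e' < 2 ^ w.
  move=> le wf vs; apply: leq_trans (eval_degree _ _ _ b_gt1 wf vs bits) _.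
  by apply: leq_trans le; rewrite leq_exp2l //; case: e' {wf vs} => *;
    exact: leq_maxl.
elim: e => [k|r|o e1 IH1 e2 IH2|a e IH] le wf vs;
  (apply/andP; split; first exact: top) => //.
- move: wf vs le => /= /and3P[_ wf1 wf2]; rewrite all_cat => /andP[v1 v2] le.
  rewrite -/fits IH1 ?IH2 //; apply: leq_trans le; rewrite leq_exp2l //;
    by rewrite !leq_max leqnn ?orbT.
- move: wf vs le => /= /andP[_ wf1] v1 le.
  apply: IH => //; apply: leq_trans le; rewrite leq_exp2l //.
  exact: leq_maxr.
Qed.

(* [own] describes the simulating program, [emb] the hosted one. *)
Definition abs (St own emb : state) : Prop :=
  [/\ forall r, r < 8 -> reg St r = reg own r,
      forall a, a < 32 -> arr St a =1 arr own a
    & hosts St emb].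

Lemma abs_scratch St own emb d v : 8 <= d < 32 ->
  abs St own emb -> abs (set_reg d v St) own emb.
Proof.
move=> /andP[le_d lt_d] [hr ha [er ea]]; split=> //.
  by move=> r lt_r /=; rewrite /override; case: eqP => [?|_]; [lia|exact: hr].
by split=> // r /=; rewrite /override; case: eqP => [?|_]; [lia|exact: er].
Qed.

Lemma abs_set_reg St own emb r v : r < 8 ->
  abs St own emb -> abs (set_reg r v St) (set_reg r v own) emb.
Proof.
move=> lt_r [hr ha [er ea]]; split=> //.
  by move=> r' lt_r' /=; rewrite /override; case: eqP => // _; exact: hr.
by split=> // r' /=; rewrite /override; case: eqP => [?|_]; [lia|exact: er].
Qed.

(** Registers below [d] survive, so a left operand is still available after the right one has been
    evaluated from [d.+1] on. *)
Lemma exec_compile w e St own emb d :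
  wf_expr e -> fits w own e -> 8 <= d -> d + height e <= 32 ->
  abs St own emb -> exists St',
    [/\ exec w (compile e d) St (cost e) St', reg St' d = expr_val own e,
        forall r, r < d -> reg St' r = reg St r & abs St' own emb].
Proof.
elim: e St d => [k|r|o e1 IH1 e2 IH2|a e IH] St d /=.
- rewrite andbT => _ lt_k le_d lt_d ab; exists (set_reg d k St).
  split=> /=.
  + exact: ExecConst.
  + by rewrite /override eqxx.
  + by move=> r lt_r; rewrite /override; case: eqP => //; lia.
  + by apply: abs_scratch => //; lia.
- rewrite andbT => lt_r lt_v le_d lt_d ab.
  have Er : reg St r = reg own r by case: ab => hr _ _; exact: hr.
  have val : eval_op WOr (reg St r) (reg St r) = reg own r.
    by rewrite /= PeanoNat.Nat.lor_diag.
  exists (set_reg d (eval_op WOr (reg St r) (reg St r)) St).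
  split.
  + by apply: ExecOp; rewrite val.
  + by rewrite val /= /override eqxx.
  + by move=> r' lt_r' /=; rewrite /override; case: eqP => //; lia.
  + by apply: abs_scratch => //; lia.
- move=> /and3P[bo wf1 wf2] /and3P[lt_v f1 f2] le_d lt_d ab.
  have [|St1 [x1 v1 k1 ab1]] := IH1 St d wf1 f1 le_d _ ab; first lia.
  have [||St2 [x2 v2 k2 ab2]] := IH2 St1 d.+1 wf2 f2 _ _ ab1; [lia..|].
  have val : eval_op o (reg St2 d) (reg St2 d.+1) =
             eval_op o (expr_val own e1) (expr_val own e2) by rewrite k2 // v1
               v2.
  exists (set_reg d (eval_op o (reg St2 d) (reg St2 d.+1)) St2); split.
  + by do 2?[apply: ExecSeq; first eassumption]; apply: ExecOp; rewrite val.
  + by rewrite val /= /override eqxx.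
  + move=> r lt_r /=; rewrite /override; case: eqP => [?|_]; first lia.
    by rewrite k2 ?k1 //; lia.
  + by apply: abs_scratch => //; lia.
- move=> /andP[lt_a wf] /andP[lt_v f] le_d lt_d ab.
  have [St1 [x1 v1 k1 ab1]] := IH St d wf f le_d lt_d ab.
  have val : arr St1 a (reg St1 d) = arr own a (expr_val own e).
    by rewrite v1; case: ab1 => _ -> .
  have le_h : 0 < height e.
    by elim: (e) => // *; rewrite leq_max; apply/orP; left.
  exists (set_reg d (arr St1 a (reg St1 d)) St1); split.
  + by apply: ExecSeq; first eassumption; apply: ExecRead; rewrite val.
  + by rewrite val /= /override eqxx.
  + move=> r lt_r /=; rewrite /override; case: eqP => [?|_]; first lia.
    by rewrite k1.
  + by apply: abs_scratch => //; lia.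
Qed.

(* Weakest precondition with time credits: the third argument of the
   assertions counts the steps that may still be taken. *)
Definition wp (w : nat) (c : com) (Q : state -> state -> nat -> Prop)
    (own emb : state) (credit : nat) : Prop :=
  forall St, abs St own emb -> exists St' k own' emb' credit',
    [/\ exec w c St k St', abs St' own' emb', k + credit' <= credit
      & Q own' emb' credit'].

Lemma wp_conseq w c (Q Q' : state -> state -> nat -> Prop) own emb credit :
  (forall o e k, Q o e k -> Q' o e k) ->
  wp w c Q own emb credit -> wp w c Q' own emb credit.
Proof.
move=> QQ' H St /H[St' [k [ o [e [cr [? ? ? /QQ' ?]]]]]].
by exists St', k, o, e, cr.
Qed.

Lemma wp_seq w c1 c2 Q own emb credit :
  wp w c1 (wp w c2 Q) own emb credit -> wp w (Seq c1 c2) Q own emb credit.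
Proof.
move=> H St /H[St1 [k1 [ o1 [e1 [cr1 [x1 ab1 le1 H2]]]]]].
have [St2 [k2 [ o2 [e2 [cr2 [x2 ab2 le2 q]]]]]] := H2 _ ab1.
exists St2, (k1 + k2), o2, e2, cr2; split=> //; last lia.
exact: ExecSeq x1 x2.
Qed.

Lemma wp_skip w (Q : state -> state -> nat -> Prop) own emb credit :
  0 < credit -> Q own emb (credit - 1) -> wp w Skip Q own emb credit.
Proof.
move=> cr q St ab; exists St, 1, own, emb, (credit - 1); split=> //; last lia.
exact: ExecSkip.
Qed.

(** The scratch registers are 8 to 31; height 23 leaves room for an expression evaluated from
    register 9 on, as in [store_hosted]. *)
Definition usable (w : nat) (own : state) (e : expr) : bool :=
  [&& wf_expr e, fits w own e & height e <= 23].

Definition assign (r : nat) (e : expr) : com :=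
  Seq (compile e 8) (Op r WOr 8 8).

Lemma fits_eval w own e : fits w own e -> expr_val own e < 2 ^ w.
Proof. by case: e => [?|?|? ? ?|? ?] /= /andP[]. Qed.

Lemma wp_assign w r e (Q : state -> state -> nat -> Prop) own emb credit :
  r < 8 -> usable w own e -> (cost e).+1 <= credit ->
  Q (set_reg r (expr_val own e) own) emb (credit - (cost e).+1) ->
  wp w (assign r e) Q own emb credit.
Proof.
move=> lt_r /and3P[wf f h] cr q St ab.
have [|St1 [x1 v1 _ ab1]] := exec_compile w e St own emb 8 wf f isT _ ab.
  lia.
have val : eval_op WOr (reg St1 8) (reg St1 8) = expr_val own e.
  by rewrite /= PeanoNat.Nat.lor_diag.
exists (set_reg r (expr_val own e) St1), (cost e + 1), (set_reg r (expr_val own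
  e) own),
  emb, (credit - (cost e).+1); split=> //; last lia.
  apply: ExecSeq x1 _; rewrite -val; apply: ExecOp.
  by rewrite val; apply: fits_eval.
exact: abs_set_reg.
Qed.

Definition assign_hosted (r : nat) (e : expr) : com :=
  Seq (compile e 8) (Op (32 + r) WOr 8 8).

Lemma wp_assign_hosted w r e (Q : state -> state -> nat -> Prop)
    own emb credit :
  usable w own e -> (cost e).+1 <= credit ->
  Q own (set_reg r (expr_val own e) emb) (credit - (cost e).+1) ->
  wp w (assign_hosted r e) Q own emb credit.
Proof.
move=> /and3P[wf f h] cr q St ab.
have [|St1 [x1 v1 _ ab1]] := exec_compile w e St own emb 8 wf f isT _ ab.
  lia.
have val : eval_op WOr (reg St1 8) (reg St1 8) = expr_val own e.
  by rewrite /= PeanoNat.Nat.lor_diag.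
exists (set_reg (32 + r) (expr_val own e) St1), (cost e + 1), own,
  (set_reg r (expr_val own e) emb), (credit - (cost e).+1); split=> //;
    last lia.
  apply: ExecSeq x1 _; rewrite -val; apply: ExecOp.
  by rewrite val; apply: fits_eval.
case: ab1 => hr ha he; split; [|exact: ha|exact: hosts_set_reg].
move=> r' lt_r'; rewrite -hr //.
by have [-> //] := same_own_set_reg St1 r (expr_val own e); lia.
Qed.

Definition store_hosted (a : nat) (ei ev : expr) : com :=
  Seq (compile ei 8) (Seq (compile ev 9) (Write (32 + a) 8 9)).

Lemma wp_store_hosted w a ei ev (Q : state -> state -> nat -> Prop)
    own emb credit :
  usable w own ei -> usable w own ev -> (cost ei + cost ev).+1 <= credit ->
  Q own (set_cell a (expr_val own ei) (expr_val own ev) emb)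
    (credit - (cost ei + cost ev).+1) ->
  wp w (store_hosted a ei ev) Q own emb credit.
Proof.
move=> /and3P[wf1 f1 h1] /and3P[wf2 f2 h2] cr q St ab.
have [|St1 [x1 v1 _ ab1]] := exec_compile w ei St own emb 8 wf1 f1 isT _ ab.
  lia.
have [|St2 [x2 v2 k2 ab2]] := exec_compile w ev St1 own emb 9 wf2 f2 isT _ ab1.
  lia.
have {k2}k2 : reg St2 8 = expr_val own ei by rewrite k2 // v1.
exists (set_cell (32 + a) (expr_val own ei) (expr_val own ev) St2),
  (cost ei + (cost ev + 1)), own, (set_cell a (expr_val own ei) (expr_val own
    ev) emb),
  (credit - (cost ei + cost ev).+1); split=> //; last lia.
  apply: ExecSeq x1 _; apply: ExecSeq x2 _; rewrite -v2 -k2; apply: ExecWrite.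
  by rewrite v2; apply: fits_eval.
case: ab2 => hr ha he; split; [exact: hr| |exact: hosts_set_cell].
move=> a' lt_a' i; rewrite -ha //.
by have [_ ->] := same_own_set_cell St2 a (expr_val own ei) (expr_val own ev).
Qed.

Definition branch (e : expr) (c1 c2 : com) : com :=
  Seq (compile e 8) (If 8 c1 c2).

Lemma wp_branch w e c1 c2 Q own emb credit :
  usable w own e -> (cost e).+1 <= credit ->
  (if expr_val own e != 0 then wp w c1 Q own emb (credit - (cost e).+1)
   else wp w c2 Q own emb (credit - (cost e).+1)) ->
  wp w (branch e c1 c2) Q own emb credit.
Proof.
move=> /and3P[wf f h] cr q St ab.
have [|St1 [x1 v1 _ ab1]] := exec_compile w e St own emb 8 wf f isT _ ab.
  lia.
case: ifP q => nz q; have [St2 [k2 [ o2 [e2 [cr2 [x2 ab2 le2 q2]]]]]] := q _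
  ab1;
  (exists St2, (cost e + k2.+1), o2, e2, cr2; split=> //; last lia);
  apply: ExecSeq x1 _.
- by apply: ExecIfTrue x2; rewrite v1.
- by apply: ExecIfFalse x2; rewrite v1; move: nz; case: (expr_val own e).
Qed.

Lemma wp_call w c (Q : state -> state -> nat -> Prop) own emb k emb' credit :
  exec w c emb k emb' -> k <= credit -> Q own emb' (credit - k) ->
  wp w (hosted c) Q own emb credit.
Proof.
move=> x le q St [hr ha he].
have [St' [x' he' [sr sa]]] := exec_hosted w c emb k emb' x _ he.
exists St', k, own, emb', (credit - k); split=> //; last lia.
split=> //.
  by move=> r lt_r; rewrite sr ?hr //; lia.
by move=> a lt_a i; rewrite sa // ha.
Qed.

(* [r := r || (hosted 0 && (hosted 1 < reg rt))]; the hosted register 1 is only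
   compared, as its value need not be meaningful when register 0 is [0]. *)
Definition test_hosted (r rt : nat) : com :=
  Seq (Op 8 WLt 33 rt) (Seq (Op 8 WAnd 8 32) (Op r WOr r 8)).

Lemma land_bool (x y : bool) : Nat.land x y = (x && y).
Proof. by case: x; case: y. Qed.

Lemma lor_bool (x y : bool) : Nat.lor x y = (x || y).
Proof. by case: x; case: y. Qed.

Lemma wp_test_hosted w r rt (acc b : bool) (Q : state -> state -> nat -> Prop)
    own emb credit :
  0 < w -> r < 8 -> rt < 8 -> reg own r = acc -> reg emb 0 = b -> 3 <= credit ->
  Q (set_reg r (acc || b && (reg emb 1 < reg own rt)) own) emb (credit - 3) ->
  wp w (test_hosted r rt) Q own emb credit.
Proof.
move=> w_gt0 lt_r lt_rt accE bE cr q St ab.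
have bit (x : bool) : x < 2 ^ w.
  apply: (leq_ltn_trans (leq_b1 x)).
  by rewrite -{1}(expn0 2) ltn_exp2l.
have E33 : reg St 33 = reg emb 1 by case: ab => _ _ [h _]; exact: (h 1).
have E32 : reg St 32 = b by rewrite -bE; case: ab => _ _ [h _]; exact: (h 0).
have Ert : reg St rt = reg own rt by case: ab => h _ _; exact: h.
have Er : reg St r = acc by rewrite -accE; case: ab => h _ _; exact: h.
set lt := reg emb 1 < reg own rt.
pose St1 := set_reg 8 lt St.
pose St2 := set_reg 8 (lt && b) St1.
exists (set_reg r (acc || b && lt) St2), 3,
  (set_reg r (acc || b && lt) own), emb, (credit - 3); split=> //; last lia.
- rewrite (_ : 3 = 1 + (1 + 1)) //.
  apply: (@ExecSeq _ _ _ _ St1).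
    have := @ExecOp w 8 WLt 33 rt St; rewrite /= E33 Ert; apply; exact: bit.
  apply: (@ExecSeq _ _ _ _ St2).
    have := @ExecOp w 8 WAnd 8 32 St1.
    rewrite /= {1 2}/override /= {1 2}/override /= E32 land_bool.
    by apply; exact: bit.
  have := @ExecOp w r WOr r 8 St2.
  have -> : reg St2 r = acc.
    by rewrite /= /override; case: eqP => [?|_]; [lia|].
  by rewrite /= {1 2}/override /= lor_bool (andbC lt); apply; exact: bit.
- by apply: abs_set_reg => //; do 2?apply: abs_scratch.
Qed.

Definition for_loop (r rb : nat) (body : com) : com :=
  Seq (assign r (EC 0))
    (Seq (compile (EO WLt (ER r) (ER rb)) 8)
      (While 8 (Seq body
         (Seq (assign r (EO WAdd (ER r) (EC 1)))
              (compile (EO WLt (ER r) (ER rb)) 8))))).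

(** Ten credits per iteration cover increment, test and branching; ten more cover the initialisation
    and the failing test. The invariant is required after the increment of the index. *)
Lemma wp_for w r rb body m (I : nat -> state -> state -> nat -> Prop)
    (Q : state -> state -> nat -> Prop) own emb credit :
  r < 8 -> rb < 8 -> r != rb -> 0 < w -> m < 2 ^ w -> reg own rb = m ->
  10 <= credit -> I 0 (set_reg r 0 own) emb (credit - 10) ->
  (forall i o e k, i < m -> reg o r = i -> reg o rb = m -> I i o e k ->
     wp w body (fun o' e' k' => [/\ reg o' r = i, reg o' rb = m, 10 <= k'
       & I i.+1 (set_reg r i.+1 o') e' (k' - 10)]) o e k) ->
  (forall o e k, reg o rb = m -> I m o e k -> Q o e k) ->
  wp w (for_loop r rb body) Q own emb credit.
Proof.
move=> lt_r lt_rb ne w_gt0 lt_m rbE cr I0 step out.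
have pw : 1 < 2 ^ w by rewrite -{1}(expn0 2) ltn_exp2l.
have test i o : i <= m -> reg o r = i -> reg o rb = m ->
    usable w o (EO WLt (ER r) (ER rb)).
  move=> le_i oi om; apply/and3P; split=> //=; first by rewrite lt_r.
  by rewrite oi om; case: (i < m); lia.
(* Induction on the number of remaining iterations. The extra unit in [k.+1] pays for the last,
   failing test. *)
have loop i St o e k : i <= m -> reg o r = i -> reg o rb = m -> I i o e k ->
    abs St o e -> reg St 8 = (i < m) -> exists St' k1 o' e' k',
    [/\ exec w (While 8 (Seq body
          (Seq (assign r (EO WAdd (ER r) (EC 1)))
               (compile (EO WLt (ER r) (ER rb)) 8)))) St k1 St',
        abs St' o' e', k1 + k' <= k.+1 & Q o' e' k'].
  move eqd: (m - i) => d;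
    elim: d => [|d IH] in i eqd St o e k * => le_i oi om Ii
    ab E8.
    have Ei : i = m by lia.
    exists St, 1, o, e, k; split=> //; last by apply: out; rewrite // -{1}Ei.
    by apply: ExecWhileFalse; rewrite E8 Ei ltnn.
  have lt_i : i < m by lia.
  have [St1 [k1 [ o1 [e1 [c1 [x1 ab1 le1 [ oi1 om1 cr1 I1]]]]]]] :=
    step _ _ _ _ lt_i oi om Ii _ ab.
  have next : wp w (assign r (EO WAdd (ER r) (EC 1)))
      (fun o' e' k' => [/\ o' = set_reg r i.+1 o1, e' = e1 & k' = c1 - 4])
      o1 e1 c1.
    apply: wp_assign => //=; last by rewrite oi1 addn1.
      apply/and3P; split=> //=; first by rewrite lt_r.
      by rewrite oi1 addn1 pw !andbT; apply/andP; split; lia.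
    lia.
  have [St2 [k2 [ o2 [e2 [c2 [x2 ab2 le2 [E1 E2 E3]]]]]]] := next _ ab1.
  subst o2 e2 c2.
  have oi2 : reg (set_reg r i.+1 o1) r = i.+1 by rewrite /= /override eqxx.
  have om2 : reg (set_reg r i.+1 o1) rb = m.
    by rewrite /= /override eq_sym (negPf ne).
  have us := test _ _ lt_i oi2 om2; case/and3P: us => wf f h.
  have [|St3 [x3 v3 _ ab3]] := exec_compile _ _ _ _ _ 8 wf f isT _ ab2.
    by rewrite /=; lia.
  have v3' : reg St3 8 = (i.+1 < m)
    by rewrite v3 /= /override eqxx [rb == r]eq_sym (negPf ne) om1.
  have [|St4 [k4 [ o4 [e4 [c4 [x4 ab4 le4 q4]]]]]] :=
    IH i.+1 _ _ _ _ (c1 - 10) lt_i oi2 om2 I1 ab3 v3'; first lia.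
  exists St4, (k1 + (k2 + cost (EO WLt (ER r) (ER rb))) + k4).+1, o4, e4, c4.
  split=> //; last by rewrite /=; lia.
  apply: ExecWhileTrue x4; first by rewrite E8 lt_i.
  by apply: ExecSeq x1 _; apply: ExecSeq x2 x3.
rewrite /for_loop; apply: wp_seq; apply: wp_assign => //=.
  by rewrite /usable /= andbT; lia.
  by lia.
move=> St ab.
have oi : reg (set_reg r 0 own) r = 0 by rewrite /= /override eqxx.
have om : reg (set_reg r 0 own) rb = m.
  by rewrite /= /override eq_sym (negPf ne).
have us := test _ _ (leq0n m) oi om; case/and3P: us => wf f h.
have [|St3 [x3 v3 _ ab3]] := exec_compile _ _ _ _ _ 8 wf f isT _ ab.
  by rewrite /=; lia.
have v3' : reg St3 8 = (0 < m)
  by rewrite v3 /= /override eqxx [rb == r]eq_sym (negPf ne) rbE.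
have [St4 [k4 [ o4 [e4 [c4 [x4 ab4 le4 q4]]]]]] :=
  loop 0 _ _ _ _ (leq0n m) oi om I0 ab3 v3'.
exists St4, (cost (EO WLt (ER r) (ER rb)) + k4), o4, e4, c4; split=> //=.
  exact: ExecSeq x3 x4.
lia.
Qed.

(** * The layered graph *)

(** Position [a] of layer [l]. Positions range below [2 * n], since the layers 4 and 7 hold sums
    [j + q]; this makes [24 * n] nodes. *)
Definition node (l a : nat) : nat := 12 * a + l.

Lemma node_mod l a : l < 12 -> node l a %% 12 = l.
Proof. by rewrite /node; lia. Qed.

Lemma node_div l a : l < 12 -> node l a %/ 12 = a.
Proof. by rewrite /node; lia. Qed.

Lemma node_eq l a x : l < 12 -> (x == node l a) = (x %% 12 == l) && (x %/ 12 ==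
  a).
Proof. by rewrite /node; lia. Qed.

Definition timed (l : nat) : bool := l \in [:: 1; 3; 4; 6; 7; 9].

Definition src (l q j : nat) : nat :=
  match l with 1 => q | 4 | 7 => j + q | _ => j end.

Definition dst (l q j : nat) : nat :=
  match l with 3 | 6 => j + q | 9 => q | _ => j end.

(* [pr l q j]: the timed edge of label [q] and index [j] between the layers [l]
   and [l.+1] is present.  Layers 4 and 7 have positions [j + q]. *)
Definition layer_edge (n : nat) (A : nat -> nat -> bool)
    (pr : nat -> nat -> nat -> bool) (l a b : nat) : bool :=
  match l with
  | 0 => (a == 0) && (b < n)
  | 1 => [&& a < n, b < n & pr 1 a b]
  | 2 | 5 | 8 => [&& a < n, b < n & A a b]
  | 3 | 6 => [&& a < n, a <= b, b < a + n & pr l (b - a) a]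
  | 4 | 7 => [&& b < n, b <= a, a < b + n & pr l (a - b) b]
  | 9 => [&& a < n, b < n & pr 9 b a]
  | 10 => (a < n) && (b == 0)
  | _ => false
  end.

Definition up_edge (n : nat) (A : nat -> nat -> bool)
    (pr : nat -> nat -> nat -> bool) (x y : nat) : bool :=
  (y %% 12 == (x %% 12).+1) && layer_edge n A pr (x %% 12) (x %/ 12) (y %/ 12).

Definition graph (n : nat) (A : nat -> nat -> bool)
    (pr : nat -> nat -> nat -> bool) : rel 'I_(24 * n) :=
  fun x y => up_edge n A pr x y || up_edge n A pr y x.

Definition offset (n l a : nat) : nat :=
  match l with
  | 1 | 10 => n * a
  | 2 | 9 => a
  | 3 | 5 | 6 | 8 => n - a
  | 4 | 7 => 2 * a
  | _ => 0
  end.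

(* [16 n^2] exceeds the sum of the offsets along any light path, so that light
   paths visit each layer once. *)
Definition weight (n x : nat) : nat :=
  16 * (n * n) + offset n (x %% 12) (x %/ 12).

(** The summands are the base weights of 12 nodes, [2 * n] for each of the two detours, the rank
    [n * q + i] paid at both ends, and the label [q] paid on four detour edges. *)
Definition target (n q i : nat) : nat :=
  12 * (16 * (n * n)) + 4 * n + 2 * (n * q + i) + 4 * q.

Lemma graphP n A pr : is_graph (graph n A pr).
Proof.
split=> [x y|x]; first by rewrite /graph orbC.
by rewrite /graph /up_edge; apply/negbTE; rewrite negb_or !negb_and; lia.
Qed.

Lemma weight_bound n x : x < 24 * n -> weight n x <= (24 * n) ^ 2.
Proof.
move=> lt_x; have : x %/ 12 < 2 * n by lia.
rewrite /weight /offset expnS expn1.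
move: (x %/ 12) (x %% 12) => a l lt_a.
have na : n * a <= 2 * (n * n) by nia.
have nn : n <= n * n by nia.
by do 11?[case: l => [|l]; first lia]; lia.
Qed.

(** * Light paths and triangles *)

Lemma path_layer n A pr (x : 'I_(24 * n)) p :
  path (graph n A pr) x p -> last x p %% 12 <= x %% 12 + size p.
Proof.
elim: p x => [|y p IH] x /=; first by rewrite addn0.
move=> /andP[/orP[]/andP[/eqP E _] /IH]; lia.
Qed.

(** An edge changes the layer by exactly one, so a path attaining the bound of [path_layer] never
    steps down. *)
Lemma path_up n A pr (x : 'I_(24 * n)) p :
  path (graph n A pr) x p -> last x p %% 12 = x %% 12 + size p ->
  path (fun x y : 'I_(24 * n) => up_edge n A pr x y) x p.
Proof.
elim: p x => [|y p IH] x //= /andP[xy yp] E.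
have L := path_layer _ _ _ _ _ yp.
have {xy} xy : up_edge n A pr x y.
  by case/orP: xy => // /andP[/eqP E' _]; lia.
by rewrite xy IH //; case/andP: xy => /eqP E' _; lia.
Qed.

Lemma path_weight_size n (x : 'I_(24 * n)) p :
  16 * (n * n) * (size p).+1 <= path_weight (fun z : 'I__ => weight n z) x p.
Proof.
rewrite /path_weight -[(size p).+1]/(size (x :: p)).
elim: (x :: p) => [|y s IH]; first by rewrite muln0.
rewrite big_cons [size _]/= mulnS; apply: leq_add IH.
exact: leq_addr.
Qed.

(* At the moment of the query for the pair (q, i), the present timed edges are
   those of the current pair and some that only lie on heavier paths. *)
Record at_query (n : nat) (pr : nat -> nat -> nat -> bool) (v w : nat -> bool)
    (q i : nat) : Prop := AtQuery {
  later_ends l q' j : l \in [:: 1; 9] -> q' < n -> j < n -> pr l q' j ->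
    n * q + i <= n * q' + j;
  later_mids l q' j : l \in [:: 3; 4; 6; 7] -> q' < n -> j < n -> pr l q' j ->
    q <= q';
  now_ends l : l \in [:: 1; 9] -> pr l q i;
  now_left l j : l \in [:: 3; 4] -> j < n -> pr l q j = v j;
  now_right l j : l \in [:: 6; 7] -> j < n -> pr l q j = w j
}.

Definition triangle (n : nat) (A : nat -> nat -> bool) (v w : nat -> bool)
    (i : nat) : Prop :=
  exists j k, [/\ j < n, k < n, v j & w k] /\ [/\ A i j, A j k & A k i].

(** The target is the sum of the least possible contributions, so a path within it meets every lower
    bound with equality. These equalities make both detours return to their starting index and the
    walk close up at [i]. *)
Lemma light_path_triangle n A pr v w q i (s t : 'I_(24 * n)) p :
  at_query n pr v w q i -> q < n -> i < n ->
  s = node 0 0 :> nat -> t = node 11 0 :> nat ->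
  st_path (graph n A pr) s t p ->
  path_weight (fun z : 'I__ => weight n z) s p <= target n q i ->
  triangle n A v w i.
Proof.
move=> now lt_q lt_i sE tE /and3P[sp /eqP lastE _] light.
(* Eleven edges are necessary to climb from layer 0 to layer 11, and a thirteenth node would cost
   more than all offsets in the target together. *)
have S11 : size p = 11.
  have := path_layer _ _ _ _ _ sp; have := path_weight_size _ s p.
  rewrite lastE sE tE /= => W L; apply/eqP; rewrite eqn_leq.
  apply/andP; split; last by move: L; rewrite /node; lia.
  rewrite leqNgt; apply/negP => big.
  have : 16 * (n * n) * 13 <= target n q i.
    by apply: leq_trans (leq_trans W light); rewrite leq_mul2l; lia.
  rewrite /target; nia.
have {sp} := path_up _ _ _ _ _ sp; rewrite lastE sE tE S11 => /(_ erefl).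
move: light; rewrite /path_weight.
case: p S11 lastE => [|x1 [|x2 [|x3 [|x4 [|x5 [|x6 [|x7 [|x8 [|x9 [|x10
  [|x11 [|? ?]]]]]]]]]]]] //= _ _.
rewrite !big_cons big_nil /up_edge /weight sE.
rewrite !node_mod // !node_div //.
move=> + /and5P[/andP[/eqP m1 e0] /andP[/eqP m2 e1] /andP[/eqP m3 e2]
  /andP[/eqP m4 e3] /and5P[/andP[/eqP m5 e4] /andP[/eqP m6 e5]
  /andP[/eqP m7 e6] /andP[/eqP m8 e7] /and4P[/andP[/eqP m9 e8]
  /andP[/eqP m10 e9] /andP[/eqP m11 e10] _]]].
move: m1 m2 m3 m4 m5 m6 m7 m8 m9 m10 m11 e0 e1 e2 e3 e4 e5 e6 e7 e8 e9 e10.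
do 11?[move=> -> ] => /=.
move: (x1 %/ 12) (x2 %/ 12) (x3 %/ 12) (x4 %/ 12) (x5 %/ 12) (x6 %/ 12)
  (x7 %/ 12) (x8 %/ 12) (x9 %/ 12) (x10 %/ 12).
move=> a1 a2 a3 a4 a5 a6 a7 a8 a9 a10 _.
move=> /and3P[b1 b2 p1] /and3P[_ b3 A23] /and4P[_ c34 c43 p3]
  /and4P[b5 c54 c45 p4] /and3P[_ b6 A56] /and4P[_ c67 c76 p6]
  /and4P[b8 c87 c78 p7] /and3P[_ b9 A89] /and3P[_ b10 p9] _.
have gap x y : y <= x -> x < y + n -> x - y < n by clear; lia.
have d1 := later_ends _ _ _ _ _ _ now 1 _ _ isT b1 b2 p1.
have d9 := later_ends _ _ _ _ _ _ now 9 _ _ isT b10 b9 p9.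
have d3 : q <= a4 - a3.
  by apply: (later_mids _ _ _ _ _ _ now 3 _ _ isT (gap _ _ c34 c43) b3 p3).
have d4 : q <= a4 - a5.
  by apply: (later_mids _ _ _ _ _ _ now 4 _ _ isT (gap _ _ c54 c45) b5 p4).
have d6 : q <= a7 - a6.
  by apply: (later_mids _ _ _ _ _ _ now 6 _ _ isT (gap _ _ c67 c76) b6 p6).
have d7 : q <= a7 - a8.
  by apply: (later_mids _ _ _ _ _ _ now 7 _ _ isT (gap _ _ c87 c78) b8 p7).
rewrite /target => light.
(* Two bounds on ranks and four on labels add up to exactly the target, hence all six are
   equalities. *)
have [E1 E9 [E43 E45] [E76 E78]] : [/\ n * a1 + a2 = n * q + i,
    n * a10 + a9 = n * q + i, a4 = a3 + q /\ a5 = a3 & a7 = a6 + q /\ a8 = a6].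
  move: b3 b5 b6 b8 c34 c54 c67 c87 d1 d9 d3 d4 d6 d7 light; clear.
  move: (n * a1) (n * a10) (n * q) (n * n) => x1 x2 x3 x4.
  by move=> *; split; [lia | lia | split; lia | split; lia].
(* Modulo [n], a rank determines its index. *)
have rank x y : y < n -> n * x + y = n * q + i -> y = i.
  move=> lt_y /(congr1 (modn^~ n)).
  by rewrite ![n * _]mulnC !modnMDl !modn_small.
have {}E1 := rank _ _ b2 E1; have {}E9 := rank _ _ b9 E9.
(* The edges leaving layers 3 and 6 carry the current label, so their presence means that [v] and
   [w] select the indices. *)
move: p3 p6; rewrite E43 E76 !addKn.
rewrite (now_left _ _ _ _ _ _ now) // (now_right _ _ _ _ _ _ now) // => vj wk.
rewrite E1 in A23; rewrite E45 in A56; rewrite E78 E9 in A89.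
by exists a3, a6.
Qed.

(** Positions out of range fall back to node 0; all uses have [a < 2 * n], where [vertexE]
    applies. *)
Definition vertex (n : nat) (n_gt0 : 0 < 24 * n) (l a : nat) : 'I_(24 * n) :=
  insubd (Ordinal n_gt0) (node l a).

Lemma vertexE n n_gt0 l a : l < 12 -> a < 2 * n ->
  vertex n n_gt0 l a = node l a :> nat.
Proof.
by move=> lt_l lt_a; rewrite val_insubd /node ifT //; lia.
Qed.

Lemma triangle_light_path n n_gt0 A pr v w q i :
  at_query n pr v w q i -> q < n -> i < n -> triangle n A v w i ->
  exists2 p, st_path (graph n A pr) (vertex n n_gt0 0 0) (vertex n n_gt0 11 0) p
    & path_weight (fun z : 'I__ => weight n z) (vertex n n_gt0 0 0) p
      = target n q i.
Proof.
move=> now lt_q lt_i [j [k [[lt_j lt_k vj wk] [Aij Ajk Aki]]]].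
pose V := vertex n n_gt0.
have VE l a : l < 12 -> a < 2 * n -> V l a = node l a :> nat.
  exact: vertexE.
have small a : a < n -> a < 2 * n by lia.
have [jq kq] : j + q < 2 * n /\ k + q < 2 * n by lia.
have n0 : 0 < 2 * n by lia.
have vE := (VE 0 0 isT n0, VE 1 q isT (small _ lt_q), VE 2 i isT (small _ lt_i),
  VE 3 j isT (small _ lt_j), VE 4 _ isT jq, VE 5 j isT (small _ lt_j),
  (VE 6 k isT (small _ lt_k), VE 7 _ isT kq, VE 8 k isT (small _ lt_k),
  VE 9 i isT (small _ lt_i), VE 10 q isT (small _ lt_q), VE 11 0 isT n0)).
exists [:: V 1 q; V 2 i; V 3 j; V 4 (j + q); V 5 j; V 6 k; V 7 (k + q); V 8 k;
           V 9 i; V 10 q; V 11 0].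
  apply/and3P; split; [|by rewrite /= eqxx|]; last first.
    (* The nodes are distinct because their layers are. *)
    by apply: (@map_uniq _ _ (fun z : 'I__ => z %% 12));
      rewrite /= -/V !vE !node_mod.
  rewrite /= -/V /graph /up_edge !vE !node_mod // !node_div //= !addKn.
  rewrite !leq_addr lt_q lt_i lt_j lt_k Aij Ajk Aki.
  rewrite !(now_ends _ _ _ _ _ _ now) //.
  rewrite (now_left _ _ _ _ _ _ now 3) // (now_left _ _ _ _ _ _ now 4) //.
  rewrite (now_right _ _ _ _ _ _ now 6) // (now_right _ _ _ _ _ _ now 7) //.
  by rewrite vj wk !ltn_add2l lt_q.
rewrite /path_weight !big_cons big_nil /weight -/V !vE.
by rewrite !node_mod // !node_div //= /target; lia.
Qed.

(** * Updates of timed edges *)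

Definition is_inc (m : dyn_mode) : bool :=
  if m is Incremental then true else false.

(** [done] lists the timed edges updated so far. Insertions thus start with no timed edge and
    deletions with all of them, and both modes share one description of the graph. *)
Definition present (m : dyn_mode) (done : seq (nat * nat * nat))
    (l q j : nat) : bool :=
  ((l, q, j) \in done) == is_inc m.

Lemma present_cons m z done l q j :
  present m (z :: done) l q j =
  if (l, q, j) == z then is_inc m else present m done l q j.
Proof. by rewrite /present inE; case: (_ == z); case: m. Qed.

Lemma src_lt n l q j : q < n -> j < n -> src l q j < 2 * n.
Proof.
by move=> lt_q lt_j; rewrite /src; do 10?[case: l => [|l]]; lia.
Qed.

Lemma dst_lt n l q j : q < n -> j < n -> dst l q j < 2 * n.
Proof.
by move=> lt_q lt_j; rewrite /dst; do 10?[case: l => [|l]]; lia.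
Qed.

Lemma timed_lt l : timed l -> l < 11.
Proof. by rewrite /timed !inE; lia. Qed.

(** Label and index of a timed edge can be read off its two positions, so one update affects a
    single pair of positions. *)
Lemma layer_edge_cons n A m l q j done l' a b :
  timed l -> q < n -> j < n ->
  layer_edge n A (present m ((l, q, j) :: done)) l' a b =
  if [&& l' == l, a == src l q j & b == dst l q j] then is_inc m
  else layer_edge n A (present m done) l' a b.
Proof.
move=> tl lt_q lt_j.
case E: [&& l' == l, a == src l q j & b == dst l q j].
  case/and3P: E => /eqP -> /eqP -> /eqP ->.
  move: tl; rewrite /timed; do 10?[case: l => [|l] //=] => // _;
  by rewrite present_cons ?addKn eqxx ?leq_addr ?ltn_add2l ?lt_q ?lt_j ?andbT;
     lia.
do 11?[case: l' E => [|l'] E /=] => //; rewrite present_cons;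
case: eqP => // -[El Eq Ej]; move: E; rewrite -El -Eq -Ej /= !eqxx //= ?andbT;
  by case: (leqP a b); case: (leqP b a) => // ? ?; rewrite ?subnKC ?eqxx ?andbF.
Qed.

Lemma up_edge_timed n A pr l q j : timed l -> q < n -> j < n ->
  up_edge n A pr (node l (src l q j)) (node l.+1 (dst l q j)) = pr l q j.
Proof.
move=> tl lt_q lt_j; have lt_l := timed_lt _ tl.
rewrite /up_edge !node_mod ?node_div ?eqxx //; try by lia.
move: tl; rewrite /timed; do 10?[case: l lt_l => [|l] lt_l //=] => // _;
  by rewrite ?addKn ?leq_addr ?ltn_add2l ?lt_q ?lt_j.
Qed.

Definition tail_vertex (n : nat) (n_gt0 : 0 < 24 * n) (z : nat * nat * nat) :
    'I_(24 * n) :=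
  let: (l, q, j) := z in vertex n n_gt0 l (src l q j).

Definition head_vertex (n : nat) (n_gt0 : 0 < 24 * n) (z : nat * nat * nat) :
    'I_(24 * n) :=
  let: (l, q, j) := z in vertex n n_gt0 l.+1 (dst l q j).

Definition valid (n : nat) (z : nat * nat * nat) : bool :=
  let: (l, q, j) := z in [&& timed l, q < n & j < n].

(** An undirected update acts on both orientations, but only one of them goes up a layer; [up_back]
    discards the other. *)
Lemma update_graphE n n_gt0 A m z done : valid n z ->
  update_graph m (graph n A (present m done))
    (tail_vertex n n_gt0 z) (head_vertex n n_gt0 z)
  = graph n A (present m (z :: done)).
Proof.
case: z => [[l q] j] /and3P[tl lt_q lt_j]; have lt_l := timed_lt _ tl.
rewrite /tail_vertex /head_vertex; set x := vertex _ _ _ _;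
  set y := vertex _ _ _ _.
have xE : x = node l (src l q j) :> nat.
  by apply: vertexE; [lia | exact: src_lt].
have yE : y = node l.+1 (dst l q j) :> nat.
  by apply: vertexE; [lia | exact: dst_lt].
have upE (a b : 'I_(24 * n)) : up_edge n A (present m ((l, q, j) :: done)) a b =
    if (a == x) && (b == y) then is_inc m
    else up_edge n A (present m done) a b.
  rewrite -!val_eqE /= xE yE !node_eq; try by lia.
  rewrite /up_edge layer_edge_cons //.
  case: (b %% 12 =P (a %% 12).+1) => [->|ne].
    by rewrite eqSS; case: (a %% 12 == l) => //=; case: (a %/ 12 == _).
  by rewrite /=; case: ifP => // cond; exfalso; lia.
have up_back (a b : 'I_(24 * n)) : (a == y) && (b == x) ->
    up_edge n A (present m done) a b = false.
  case/andP=> /eqP -> /eqP ->; rewrite /up_edge xE yE !node_mod; lia.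
apply/funext => a; apply/funext => b.
rewrite /update_graph /graph !upE /same_edge [(b == x) && _]andbC.
have := up_back a b; have := up_back b a.
rewrite [(b == y) && _]andbC.
case: m {upE up_back} => /=; do 2?[case: ifP => _]; rewrite ?orbT ?orbF ?andbT
  ?andbF //.
- by move=> ->.
- by move=> _ ->.
Qed.

(** This reduces legality of a whole sequence to the absence of repeated updates, in both modes. *)
Lemma legal_updateE n n_gt0 A m z done : valid n z ->
  legal_update m (graph n A (present m done))
    (tail_vertex n n_gt0 z) (head_vertex n n_gt0 z) = (z \notin done).
Proof.
case: z => [[l q] j] /and3P[tl lt_q lt_j]; have lt_l := timed_lt _ tl.
rewrite /tail_vertex /head_vertex; set x := vertex _ _ _ _;
  set y := vertex _ _ _ _.
have xE : x = node l (src l q j) :> nat.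
  by apply: vertexE; [lia | exact: src_lt].
have yE : y = node l.+1 (dst l q j) :> nat.
  by apply: vertexE; [lia | exact: dst_lt].
have gE : graph n A (present m done) x y = present m done l q j.
  rewrite /graph xE yE up_edge_timed // /up_edge !node_mod; try by lia.
case: m gE => /= ->; rewrite /present; last by case: (_ \in _).
rewrite -val_eqE /= xE yE node_eq; last by lia.
rewrite node_mod; last by lia.
by rewrite (_ : (l == l.+1) = false); [case: (_ \in _) | lia].
Qed.

(** * Sequences of operations *)

(* [Some z] updates the timed edge [z], [None] is a query. *)
Definition to_op (n : nat) (n_gt0 : 0 < 24 * n)
    (o : option (nat * nat * nat)) : dyn_op (24 * n) :=
  if o is Some z then Update (tail_vertex n n_gt0 z) (head_vertex n n_gt0 z)
  else Query.

Definition updates (ops : seq (option (nat * nat * nat))) :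
    seq (nat * nat * nat) :=
  pmap id ops.

Lemma updates_cat s1 s2 : updates (s1 ++ s2) = updates s1 ++ updates s2.
Proof. exact: pmap_cat. Qed.

Lemma updates_flatten (S : Type) (f : S -> seq (option (nat * nat * nat))) s :
  updates (flatten (map f s)) = flatten (map (updates \o f) s).
Proof. by elim: s => //= x s IH; rewrite updates_cat IH. Qed.

(** The latest update comes first, matching the order in which single updates are put in front of
    [done]. *)
Definition advance (ops : seq (option (nat * nat * nat)))
    (done : seq (nat * nat * nat)) : seq (nat * nat * nat) :=
  rev (updates ops) ++ done.

Lemma advance_cat s1 s2 done :
  advance (s1 ++ s2) done = advance s2 (advance s1 done).
Proof. by rewrite /advance updates_cat rev_cat catA. Qed.

Lemma mem_advance ops done z :
  (z \in advance ops done) = (z \in updates ops) || (z \in done).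
Proof. by rewrite /advance mem_cat mem_rev. Qed.

Definition gadget (l q j : nat) : seq (option (nat * nat * nat)) :=
  [:: Some (l, q, j); Some (l.+1, q, j)].

(** With [b] true the selected indices are updated, with [b] false the others: insertions add the
    former, deletions first remove the latter. *)
Definition side_step (b : bool) (q : nat) (v w : nat -> bool) (j : nat) :
    seq (option (nat * nat * nat)) :=
  (if v j == b then gadget 3 q j else [::]) ++
  (if w j == b then gadget 6 q j else [::]).

Definition sides (b : bool) (n q : nat) (v w : nat -> bool) :
    seq (option (nat * nat * nat)) :=
  flatten [seq side_step b q v w j | j <- iota 0 n].

Definition idx (m : dyn_mode) (n k : nat) : nat :=
  if is_inc m then n - k.+1 else k.

(** An insertion run asks once both ends of the pair have appeared, a deletion run before they
    vanish. Deletions remove the ends of unselected indices as well. *)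
Definition end_step (m : dyn_mode) (q : nat) (u : nat -> bool) (i : nat) :
    seq (option (nat * nat * nat)) :=
  let ends := [:: Some (1, q, i); Some (9, q, i)] in
  if is_inc m then if u i then rcons ends None else [::]
  else if u i then None :: ends else ends.

Definition ends (m : dyn_mode) (n q : nat) (u : nat -> bool) (k : nat) :
    seq (option (nat * nat * nat)) :=
  flatten [seq end_step m q u (idx m n k') | k' <- iota 0 k].

Definition query_data : Type :=
  ((nat -> bool) * (nat -> bool) * (nat -> bool))%type.

(** Labels grow in a deletion run, so leftovers of a finished label would be lighter than the next
    label. In an insertion run finished labels are larger and may stay. *)
Definition closing (m : dyn_mode) (n q : nat) (v w : nat -> bool) :
    seq (option (nat * nat * nat)) :=
  if is_inc m then [::] else sides true n q v w.

Definition phase (m : dyn_mode) (n p : nat) (d : query_data) :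
    seq (option (nat * nat * nat)) :=
  let: (u, v, w) := d in
  let q := idx m n p in
  sides (is_inc m) n q v w ++ ends m n q u n ++ closing m n q v w.

Fixpoint phases (m : dyn_mode) (n p : nat) (ds : seq query_data) :
    seq (option (nat * nat * nat)) :=
  if ds is d :: ds' then phase m n p d ++ phases m n p.+1 ds' else [::].

Definition seen (m : dyn_mode) (n k j : nat) : bool :=
  if is_inc m then (n <= j + k) && (j < n) else j < k.

Lemma seenP m n k j : k <= n ->
  (j \in [seq idx m n k' | k' <- iota 0 k]) = seen m n k j.
Proof.
move=> le_k; rewrite /seen; apply/mapP/idP.
  case=> k' + ->; rewrite mem_iota /idx.
  by case: m => /=; lia.
rewrite /idx; case: m => /= H; last by exists j => //; rewrite mem_iota; lia.
by exists (n - j.+1); [rewrite mem_iota; lia | lia].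
Qed.

Lemma idx_inj m n : {in iota 0 n &, injective (idx m n)}.
Proof. by move=> a b; rewrite !mem_iota /idx; case: m => /=; lia. Qed.

Lemma has_unique (T : eqType) (P : pred T) s y :
  (forall x, P x -> x = y) -> has P s = (y \in s) && P y.
Proof.
move=> Py; apply/hasP/andP => [[x xs Px]|[ys P1]]; last by exists y.
by rewrite -(Py _ Px).
Qed.

Lemma mem_updates_flatten (S : Type) (f : S -> seq (option (nat * nat * nat)))
    s z :
  (z \in updates (flatten (map f s))) = has (fun x => z \in updates (f x)) s.
Proof. by elim: s => //= x s IH; rewrite updates_cat mem_cat IH. Qed.

Lemma mem_sides b n q v w l q' j :
  ((l, q', j) \in updates (sides b n q v w)) =
  [&& q' == q, j < n & (l \in [:: 3; 4]) && (v j == b) ||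
                       (l \in [:: 6; 7]) && (w j == b)].
Proof.
have step j' : ((l, q', j) \in updates (side_step b q v w j')) =
    [&& q' == q, j == j' & (l \in [:: 3; 4]) && (v j' == b) ||
                           (l \in [:: 6; 7]) && (w j' == b)].
  rewrite updates_cat mem_cat !inE.
  by do 2?[case: ifP => _]; rewrite /= ?inE ?xpair_eqE;
    case: (q' == q); case: (j == j'); rewrite ?andbF ?andbT ?orbF.
rewrite mem_updates_flatten (has_unique _ _ _ j).
  by rewrite mem_iota step eqxx /= add0n; case: (q' == q); rewrite ?andbF.
by move=> j'; rewrite step => /and3P[_ /eqP].
Qed.

Lemma mem_end_step m q u i l q' j :
  ((l, q', j) \in updates (end_step m q u i)) =
  [&& q' == q, l \in [:: 1; 9], j == i & is_inc m ==> u i].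
Proof.
by rewrite /end_step; case: m; case: (u i) => //=; rewrite ?inE ?xpair_eqE;
  case: (q' == q); case: (j == i); rewrite ?andbF ?andbT ?orbF.
Qed.

Lemma mem_ends m n q u k l q' j : k <= n ->
  ((l, q', j) \in updates (ends m n q u k)) =
  [&& q' == q, l \in [:: 1; 9], seen m n k j & is_inc m ==> u j].
Proof.
move=> le_k; rewrite -(seenP m n k j le_k) mem_updates_flatten.
apply/hasP/and4P => [[k' k'k]|[/eqP -> l19 /mapP[k' k'k jE] uj]].
  rewrite mem_end_step => /and4P[-> -> /eqP -> ->]; split=> //.
  by apply/mapP; exists k'.
by exists k' => //; rewrite mem_end_step eqxx l19 -jE eqxx.
Qed.

Lemma mem_closing m n q v w l q' j :
  ((l, q', j) \in updates (closing m n q v w)) =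
  [&& ~~ is_inc m, q' == q, j < n & (l \in [:: 3; 4]) && v j ||
                       (l \in [:: 6; 7]) && w j].
Proof.
rewrite /closing; case: m => //=.
by rewrite mem_sides !eqb_id.
Qed.

Lemma mem_phase m n p u v w l q' j : p < n ->
  (l, q', j) \in updates (phase m n p (u, v, w)) ->
  [&& timed l, q' == idx m n p & j < n].
Proof.
move=> lt_p; rewrite !updates_cat !mem_cat mem_sides mem_ends // mem_closing.
rewrite /timed !inE /seen; case: m => /=; case: eqP => //= _; lia.
Qed.

(* For deletions the past phases have removed all their edges. *)
Definition history (m : dyn_mode) (n p : nat) (done : seq (nat * nat * nat)) :
    Prop :=
  forall l q j, valid n (l, q, j) ->
    if is_inc m then (l, q, j) \in done -> seen m n p q
    else ((l, q, j) \in done) = seen m n p q.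

Lemma history0 m n : history m n 0 [::].
Proof. by move=> l q j _; rewrite /seen; case: m. Qed.

(** For deletions, the sides with [false] and the closing with [true] jointly exhaust the detour
    edges of the label. *)
Lemma history_phase m n p d done : p < n ->
  history m n p done -> history m n p.+1 (advance (phase m n p d) done).
Proof.
case: d => [[u v] w] lt_p H l q j vz; move: (H l q j vz).
move: vz => /and3P[tl lt_q lt_j].
rewrite mem_advance; case: m {H} => /= H.
  case/orP=> [/mem_phase|/H]; last by rewrite /seen /=; lia.
  by move=> /(_ lt_p) /and3P[_ /eqP -> _]; rewrite /seen /idx /=; lia.
rewrite !updates_cat !mem_cat mem_sides mem_ends // mem_closing H.
move: tl; rewrite /timed !inE /seen /idx /= lt_j.
case: (v j); case: (w j) => /= tl; lia.
Qed.

(** The number [k + is_inc m] counts the end steps whose updates precede the query: those of the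
    pair [k] itself are already inserted, but not yet deleted. *)
Lemma at_queryP m n p k (u v w : nat -> bool) done : p < n -> k < n ->
  history m n p done -> u (idx m n k) ->
  at_query n
    (present m
      (advance (sides (is_inc m) n (idx m n p) v w ++
                ends m n (idx m n p) u (k + is_inc m)) done))
    v w (idx m n p) (idx m n k).
Proof.
move=> lt_p lt_k H ui.
have pE l q j : timed l -> q < n -> j < n ->
    present m (advance (sides (is_inc m) n (idx m n p) v w ++
      ends m n (idx m n p) u (k + is_inc m)) done) l q j =
    (([&& q == idx m n p & (l \in [:: 3; 4]) && (v j == is_inc m) ||
                       (l \in [:: 6; 7]) && (w j == is_inc m)]
     || [&& q == idx m n p, l \in [:: 1; 9], seen m n (k + is_inc m) j
          & is_inc m ==> u j]
     || ((l, q, j) \in done)) == is_inc m).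
  move=> tl lt_q lt_j; rewrite /present mem_advance updates_cat mem_cat.
  by rewrite mem_sides mem_ends ?lt_j //=; move: lt_k; clear; case: m => /=;
    lia.
have lt_q : idx m n p < n by rewrite /idx; case: (m) => /=; lia.
have lt_i : idx m n k < n by rewrite /idx; case: (m) => /=; lia.
(* Ranks compare lexicographically, since the index of the current pair is below [n]. *)
have lexi q' j : idx m n p < q' \/ idx m n p = q' /\ idx m n k <= j ->
    n * idx m n p + idx m n k <= n * q' + j.
  case=> [lt|[-> le]]; last by rewrite leq_add2l.
  have : n * (idx m n p).+1 <= n * q' by rewrite leq_mul2l lt orbT.
  by rewrite mulnS; lia.
have timed_of l : l \in [:: 1; 9] \/ l \in [:: 3; 4; 6; 7] -> timed l.
  by rewrite /timed !inE; lia.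
have Hv l q j : timed l -> q < n -> j < n ->
    if is_inc m then (l, q, j) \in done -> seen m n p q
    else ((l, q, j) \in done) = seen m n p q.
  by move=> tl lq lj; apply: H; rewrite /valid tl lq.
have iE : idx m n k = if is_inc m then n - k.+1 else k by [].
have qE : idx m n p = if is_inc m then n - p.+1 else p by [].
split.
- move=> l q' j l19 lq' lj; have tl : timed l by apply: timed_of; left.
  rewrite pE // => pr; apply: lexi; move: pr (Hv _ _ _ tl lq' lj) iE qE.
  move: (idx m n p) (idx m n k) (_ \in done) => q i b.
  move: l19; rewrite /seen !inE; case: (m) => /=; lia.
- move=> l q' j l34 lq' lj; have tl : timed l by apply: timed_of; right.
  rewrite pE // => pr; move: pr (Hv _ _ _ tl lq' lj) qE.
  move: (idx m n p) (_ \in done) => q b.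
  move: l34; rewrite /seen !inE; case: (m) => /=; lia.
- move=> l l19; have tl : timed l by apply: timed_of; left.
  rewrite pE //; have := Hv _ _ _ tl lt_q lt_i; move: iE qE ui lt_q lt_i.
  move: (idx m n p) (idx m n k) (_ \in done) => q i b.
  by move: l19; rewrite /seen !inE; case: (m) => /=; case: (u i); lia.
- move=> l j l34 lj; have tl : timed l.
    by apply: timed_of; right; move: l34; rewrite !inE; lia.
  rewrite pE //; have := Hv _ _ _ tl lt_q lj; move: qE lt_q.
  move: (idx m n p) (_ \in done) => q b.
  by move: l34; rewrite /seen !inE; case: (m) => /=; case: (v j); lia.
- move=> l j l67 lj; have tl : timed l.
    by apply: timed_of; right; move: l67; rewrite !inE; lia.
  rewrite pE //; have := Hv _ _ _ tl lt_q lj; move: qE lt_q.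
  move: (idx m n p) (_ \in done) => q b.
  by move: l67; rewrite /seen !inE; case: (m) => /=; case: (w j); lia.
Qed.

(** * Legality and size of the operation sequences *)

Lemma uniq_flatten_key (S T K : eqType) (f : S -> seq T) (key : T -> K)
    (g : S -> K) (s : seq S) :
  uniq (map g s) -> (forall x, x \in s -> uniq (f x)) ->
  (forall x z, x \in s -> z \in f x -> key z = g x) ->
  uniq (flatten (map f s)).
Proof.
elim: s => //= x s IH /andP[gx gs] fu fk.
rewrite cat_uniq fu ?mem_head //= IH //; first last.
- by move=> y z ys; apply: fk; rewrite inE ys orbT.
- by move=> y ys; apply: fu; rewrite inE ys orbT.
(* A common element would give two different blocks the same key. *)
rewrite andbT; apply/hasPn => z /flatten_mapP[y ys zy]; apply/negP => zx.
case/negP: gx; rewrite -(fk x z) ?mem_head // (fk y z) ?inE ?ys ?orbT //.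
exact: map_f.
Qed.

Lemma uniq_sides b n q v w : uniq (updates (sides b n q v w)).
Proof.
rewrite updates_flatten.
apply: (@uniq_flatten_key _ _ _ _ (fun z => z.2) id).
- by rewrite map_id iota_uniq.
- by move=> j _ /=; rewrite /side_step; case: (v j == b); case: (w j == b).
- move=> j [[l q'] j'] _ /=; rewrite /side_step.
  by do 2?case: (_ == b); rewrite //= !inE !xpair_eqE => E; lia.
Qed.

Lemma uniq_ends m n q u k : k <= n -> uniq (updates (ends m n q u k)).
Proof.
move=> le_k; rewrite updates_flatten.
apply: (@uniq_flatten_key _ _ _ _ (fun z => z.2) (idx m n)).
- rewrite map_inj_in_uniq ?iota_uniq // => a b; rewrite !mem_iota => ha hb.
  by apply: idx_inj; rewrite mem_iota; lia.
- by move=> j _ /=; rewrite /end_step; case: is_inc; case: (u _).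
- by move=> k' [[l q'] j'] _ /=; rewrite mem_end_step => /and4P[_ _ /eqP].
Qed.

Lemma uniq_phase m n p d : uniq (updates (phase m n p d)).
Proof.
case: d => [[u v] w]; rewrite !updates_cat !cat_uniq uniq_sides uniq_ends //=.
apply/and3P; split.
- apply/hasPn => -[[l q] j];
    rewrite mem_cat mem_ends // mem_closing /= mem_sides.
  rewrite !inE; case: m => /=; case: (v j); case: (w j); lia.
- apply/hasPn => -[[l q] j]; rewrite mem_closing /= mem_ends // !inE; lia.
- by rewrite /closing; case: m => //=; apply: uniq_sides.
Qed.

Lemma mem_phases m n p ds l q j : p + size ds <= n ->
  (l, q, j) \in updates (phases m n p ds) ->
  exists2 p', p <= p' < n & [&& timed l, q == idx m n p' & j < n].
Proof.
elim: ds p => [|[[u v] w] ds IH] p //= le_n.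
rewrite updates_cat mem_cat => /orP[/mem_phase|/IH[|p' lt_p' E]]; last 2 first.
- by lia.
- by exists p' => //; lia.
by move=> H; exists p; [lia | apply: H; lia].
Qed.

(** Different phases use different labels, because [idx] is injective. *)
Lemma uniq_phases m n p ds : p + size ds <= n ->
  uniq (updates (phases m n p ds)).
Proof.
elim: ds p => [|d ds IH] p //= le_n.
rewrite updates_cat cat_uniq uniq_phase IH ?andbT /=; last by lia.
apply/hasPn => -[[l q] j] /mem_phases[|p' lt_p' /and3P[_ /eqP qE _]].
  by lia.
apply/negP; case: d => [[u v] w] /mem_phase H.
have lt_p : p < n by lia.
case/and3P: (H lt_p) => _ /eqP qE' _.
have := @idx_inj m n p p'.
rewrite !mem_iota -qE -qE' => inj; have : p = p' by apply: inj => //; lia.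
lia.
Qed.

Lemma legal_fresh n n_gt0 A m done ops :
  all (valid n) (updates ops) -> uniq (updates ops) ->
  (forall z, z \in updates ops -> z \notin done) ->
  legal_ops m (graph n A (present m done)) (map (to_op n n_gt0) ops).
Proof.
elim: ops done => [|[z|] ops IH] done //=.
  move=> /andP[vz vops] /andP[zops uops] fresh.
  rewrite legal_updateE // update_graphE // fresh ?mem_head //=.
  apply: IH => // z' z'ops; rewrite inE negb_or fresh ?inE ?z'ops ?orbT //.
  by rewrite andbT; apply: contraNneq zops => <-.
exact: IH.
Qed.

Lemma legal_phases n n_gt0 A m ds : size ds <= n ->
  legal_ops m (graph n A (present m [::]))
    (map (to_op n n_gt0) (phases m n 0 ds)).
Proof.
move=> le_n; apply: legal_fresh => //; last exact: uniq_phases.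
apply/allP => -[[l q] j] /mem_phases[|p lt_p /and3P[tl /eqP -> lj]] //.
by apply/and3P; split=> //; rewrite /idx; case: (m) => /=; lia.
Qed.

(** Without the additive one of [few_queries], the condition is preserved by concatenation. It holds
    since every query comes with the two end updates of its pair. *)
Definition balanced (ops : seq (option (nat * nat * nat))) : bool :=
  count (pred1 None) ops <= count (predC1 None) ops.

Lemma balanced_cat s1 s2 :
  balanced s1 -> balanced s2 -> balanced (s1 ++ s2).
Proof. by rewrite /balanced !count_cat => *; apply: leq_add. Qed.

Lemma balanced_flatten (S : Type) (f : S -> seq (option (nat * nat * nat))) s :
  (forall x, balanced (f x)) -> balanced (flatten (map f s)).
Proof. by move=> fb; elim: s => //= x s IH; apply: balanced_cat. Qed.

Lemma balanced_phases m n p ds : balanced (phases m n p ds).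
Proof.
have sidesb b q v w : balanced (sides b n q v w).
  apply: balanced_flatten => j; rewrite /side_step.
  by case: (_ == _); case: (_ == _).
elim: ds p => [|[[u v] w] ds IH] p //=; do 2?apply: balanced_cat => //.
apply: balanced_cat; last by rewrite /closing; case: is_inc.
by apply: balanced_flatten => i; rewrite /end_step; case: is_inc; case: (u _).
Qed.

Lemma few_queries_phases n n_gt0 m p ds :
  few_queries (map (to_op n n_gt0) (phases m n p ds)).
Proof.
rewrite /few_queries !count_map; apply: leqW.
rewrite (@eq_count _ _ (pred1 None)); last by case.
by rewrite [leqRHS](@eq_count _ _ (predC1 None)); [exact: balanced_phases|case].
Qed.

(** With every index selected by [u], each end step is nonempty. This yields the lower bound on the
    running time in [square_le_time]. *)
Lemma size_phases_all m n p ds :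
  n * size ds <= size (phases m n p (map (fun d => (xpredT, d.1, d.2)) ds)).
Proof.
have ge_ends q k : k <= size (ends m n q xpredT k).
  rewrite /ends -[k in leqLHS](size_iota 0).
  elim: (iota 0 k) => //= i s IH; rewrite size_cat -add1n leq_add //.
  by rewrite /end_step; case: is_inc.
elim: ds p => [|d ds IH] p /=; first by rewrite muln0.
rewrite mulnS size_cat leq_add // /phase !size_cat.
by have := ge_ends (idx m n p) n; lia.
Qed.

(** * Answering the OMv3 queries *)

Definition etruth (a : nat) (r : nat) (b : bool) : expr :=
  EO WEq (EA a (ER r)) (EC b).

Definition enode (l : nat) (e : expr) : expr :=
  EO WAdd (EO WMul (EC 12) e) (EC l).

(* Own registers: 1 holds n, 2 the number p of finished phases, 3 the label q
   of the current phase, 4 and 5 loop indices, 6 the answer so far and 7 the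
   successor of the target. *)
Definition esrc (l : nat) : expr :=
  match l with 1 => ER 3 | 4 | 7 => EO WAdd (ER 5) (ER 3) | _ => ER 5 end.

Definition edst (l : nat) : expr :=
  match l with 3 | 6 => EO WAdd (ER 5) (ER 3) | 9 => ER 3 | _ => ER 5 end.

Definition eidx (m : dyn_mode) (r : nat) : expr :=
  if is_inc m then EO WSub (ER 1) (EO WAdd (ER r) (EC 1)) else ER r.

Definition etarget : expr :=
  let mul := EO WMul in let add := EO WAdd in
  add (add (add (mul (EC 12) (mul (EC 16) (mul (ER 1) (ER 1))))
                (mul (EC 4) (ER 1)))
           (mul (EC 2) (add (mul (ER 1) (ER 3)) (ER 5))))
      (add (mul (EC 4) (ER 3)) (EC 1)).

Definition framed (rs : seq nat) (o1 o2 : state) : Prop :=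
  (forall r, r \notin rs -> reg o2 r = reg o1 r) /\ arr o2 = arr o1.

Lemma framed_refl rs o : framed rs o o.
Proof. by []. Qed.

Lemma framed_set_reg rs o1 o2 r v :
  r \in rs -> framed rs o1 o2 -> framed rs o1 (set_reg r v o2).
Proof.
move=> r_rs [fr fa]; split=> // r' r'_rs /=; rewrite /override.
by case: eqP => [E|_]; [rewrite E r_rs in r'_rs | exact: fr].
Qed.

Lemma framed_trans rs o1 o2 o3 :
  framed rs o1 o2 -> framed rs o2 o3 -> framed rs o1 o3.
Proof.
by move=> [r12 a12] [r23 a23]; split=> [r h|]; rewrite ?a23 // r23 // r12.
Qed.

Lemma framed_sub rs rs' o1 o2 :
  {subset rs <= rs'} -> framed rs o1 o2 -> framed rs' o1 o2.
Proof.
move=> sub [fr fa]; split=> // r h; apply: fr; apply: contra h; exact: sub.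
Qed.

(* A record, so that unification never unfolds the powers. *)
Record wide (n w : nat) : Prop := Wide { wideP : n.+1 ^ 100 <= 2 ^ w }.

Section Phase.

Variables (m : dyn_mode) (n c w : nat) (upd qry : com).
Hypothesis n_gt0 : 0 < n.
Variable N_gt0 : 0 < 24 * n.
Hypothesis w_wide : wide n w.
Hypothesis w_hosted : word_size c (24 * n) <= w.
Variable A : nat -> nat -> bool.

Lemma width_gt0 : 0 < w.
Proof.
have : 2 ^ 0 < 2 ^ w by apply: leq_trans (wideP _ _ w_wide);
  rewrite expn0 -{1}(exp1n 100)
  ltn_exp2r.
by rewrite ltn_exp2l.
Qed.

(** Removing duplicates leaves, after computation, one side condition per register. *)
Lemma usable_degree o e :
  wf_expr e -> max_degree e <= 100 -> height e <= 23 ->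
  all (fun r => reg o r < n.+1 ^ 20) (undup (vars e)) ->
  (forall a i, arr o a i <= 1) ->
  usable w o e.
Proof.
move=> wf deg h vs bits; rewrite /usable wf h andbT.
apply: (@fits_degree w n.+1) => //.
  by apply: leq_trans (wideP _ _ w_wide); rewrite leq_exp2l.
by apply/allP => r rv; apply: (allP vs); rewrite mem_undup.
Qed.

Lemma lt_pow20 x : x <= n -> x < n.+1 ^ 20.
Proof. by move=> le; apply: (@leq_trans n.+1);
  rewrite // -{1}(expn1 n.+1) leq_exp2l. Qed.

Lemma lt_word x : x <= n -> x < 2 ^ w.
Proof.
move=> le; apply: leq_trans (lt_pow20 _ le) _.
by apply: leq_trans (wideP _ _ w_wide); rewrite leq_exp2l.
Qed.

Definition serving (emb : state) (done : seq (nat * nat * nat))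
    (ops : seq (option (nat * nat * nat))) (k : nat) : Prop :=
  nwstSP_serves m (word_size c (24 * n)) (fun x : 'I__ => weight n x)
    (vertex n N_gt0 0 0) (vertex n N_gt0 11 0) upd qry
    (graph n A (present m done)) emb (map (to_op n N_gt0) ops) k.

(** The credit covers the hosted algorithm on all operations still to come and leaves [slack] steps
    to the simulation; this fits a bound on total rather than individual time. *)
Definition budget (emb : state) (done : seq (nat * nat * nat))
    (ops : seq (option (nat * nat * nat))) (slack credit : nat) : Prop :=
  exists2 k, serving emb done ops k & k + slack <= credit.

(** Register 1 is set before register 0, so that the resulting hosted state is literally a
    [put_edge]. *)
Definition do_update (l : nat) : com :=
  Seq (assign_hosted 1 (enode l.+1 (edst l)))
    (Seq (assign_hosted 0 (enode l (esrc l))) (hosted upd)).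

Definition good_own (q : nat) (o : state) : Prop :=
  [/\ reg o 1 = n, reg o 3 = q, q < n & forall a i, arr o a i <= 1].

Lemma wp_update l q j o emb done ops slack credit
    (Q : state -> state -> nat -> Prop) :
  timed l -> good_own q o -> reg o 5 = j -> j < n ->
  budget emb done (Some (l, q, j) :: ops) (slack + 20) credit ->
  (forall emb' credit', budget emb' ((l, q, j) :: done) ops slack credit' ->
     Q o emb' credit') ->
  wp w (do_update l) Q o emb credit.
Proof.
move=> tl [ o1 o3 lt_q bits] o5 lt_j [k srv le_k] post.
have esrcE : expr_val o (esrc l) = src l q j.
  by rewrite /esrc /src; move: (l) => l0; do 8?[case: l0 => [|l0] /=];
    rewrite ?o3 ?o5.
have edstE : expr_val o (edst l) = dst l q j.
  by rewrite /edst /dst; move: (l) => l0; do 10?[case: l0 => [|l0] /=];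
    rewrite ?o3 ?o5.
have [us1 us2 c1 c2] : [/\ usable w o (enode l (esrc l)),
    usable w o (enode l.+1 (edst l)), cost (enode l (esrc l)) <= 7
    & cost (enode l.+1 (edst l)) <= 7].
  have r3 : reg o 3 < n.+1 ^ 20 by rewrite o3 lt_pow20 // ltnW.
  have r5 : reg o 5 < n.+1 ^ 20 by rewrite o5 lt_pow20 // ltnW.
  move: (l) tl => l0; rewrite /timed; do 10?[case: l0 => [|l0] //=] => // _;
  by split=> //; apply: usable_degree => //=; rewrite ?r3 ?r5.
move: srv => /= [k1 [st1 [k2 [x1 srv2 kE]]]].
apply: wp_seq; apply: wp_assign_hosted => //; first by lia.
apply: wp_seq; apply: wp_assign_hosted => //; first by lia.
have lt_l := timed_lt _ tl.
have x1' : exec w upd (set_reg 0 (expr_val o (enode l (esrc l)))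
    (set_reg 1 (expr_val o (enode l.+1 (edst l))) emb)) k1 st1.
  apply: exec_widen w_hosted _; move: x1; rewrite /put_edge.
  rewrite !vertexE ?src_lt ?dst_lt //; last by lia.
  by rewrite /node /= esrcE edstE.
apply: wp_call x1' _ _; first by lia.
apply: post; exists k2; last by lia.
by rewrite /serving -(update_graphE n N_gt0 A m (l, q, j)) // /valid tl lt_q.
Qed.

Definition ask : com :=
  Seq (assign 7 etarget) (Seq (hosted qry) (test_hosted 6 7)).

Lemma wp_ask q i (acc : bool) v u o emb done ops slack credit
    (Q : state -> state -> nat -> Prop) :
  good_own q o -> reg o 5 = i -> i < n -> reg o 6 = acc ->
  at_query n (present m done) v u q i ->
  budget emb done (None :: ops) (slack + 50) credit ->
  (forall o' emb' credit', framed [:: 6; 7] o o' ->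
     reg o' 6 = (acc || `[< triangle n A v u i >]) ->
     budget emb' done ops slack credit' -> Q o' emb' credit') ->
  wp w ask Q o emb credit.
Proof.
move=> [ o1 o3 lt_q bits] o5 lt_i o6 now [k srv le_k] post.
have us : usable w o etarget.
  apply: usable_degree => //=.
  by rewrite o1 o3 o5 !lt_pow20 // ltnW.
move: srv => /= [k1 [st1 [k2 [x1 out srv2 kE]]]].
apply: wp_seq; apply: wp_assign => //; first by rewrite /=; lia.
have -> : expr_val o etarget = (target n q i).+1.
  by rewrite /target /= o1 o3 o5; lia.
apply: wp_seq; apply: wp_call (exec_widen _ _ _ _ _ _ w_hosted x1) _ _.
  by rewrite /=; lia.
(* If the output says unreachable, there is no triangle, as it would provide a path. Otherwise the
   least path weight is compared with the target, using both directions of the correspondence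
   between light paths and triangles. *)
have [b bE dist] : exists2 b : bool, reg st1 0 = b &
    b && (reg st1 1 < (target n q i).+1) = `[< triangle n A v u i >].
  case: out => [[-> none]|[-> [p pst pw] least]].
    exists false => //; apply/esym/asboolPn => tri.
    have [p pst _] := triangle_light_path n N_gt0 A _ _ _ q i now lt_q lt_i tri.
    by move: (none p); rewrite pst.
  exists true => //=; apply/idP/asboolP; rewrite ltnS.
    rewrite -pw; apply: light_path_triangle now lt_q lt_i _ _ pst;
      rewrite vertexE //; lia.
  move=> tri.
  have [p' pst' <-] := triangle_light_path n N_gt0 A _ _ _ q i now lt_q lt_i
    tri.
  exact: least.
have o6' : reg (set_reg 7 (target n q i).+1 o) 6 = acc by [].
apply: (wp_test_hosted _ _ _ acc b) => //; first exact: width_gt0.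
  by rewrite /=; lia.
rewrite [reg _ 7]/= dist.
apply: post => //.
  by do 2?apply: framed_set_reg => //.
by exists k2 => //=; lia.
Qed.

(** Iteration [k] consumes the operations [f k] from the front of the remaining sequence; [D] pays
    for the body's own steps and 10 for the control of the loop. *)
Lemma wp_for_ops r rs body (f : nat -> seq (option (nat * nat * nat)))
    (J : nat -> state -> Prop) D o emb done ops slack credit
    (Q : state -> state -> nat -> Prop) :
  r < 8 -> r \in rs -> 1 \notin rs -> reg o 1 = n ->
  budget emb done (flatten [seq f k | k <- iota 0 n] ++ ops)
    (slack + (D + 10) * n + 10) credit ->
  J 0 (set_reg r 0 o) ->
  (forall k o1 emb1 ops1 slack1 credit1,
     let done1 := advance (flatten [seq f k' | k' <- iota 0 k]) done in
     k < n -> framed rs o o1 -> reg o1 r = k -> J k o1 ->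
     budget emb1 done1 (f k ++ ops1) (slack1 + D) credit1 ->
     wp w body (fun o2 emb2 credit2 => [/\ framed rs o o2, reg o2 r = k,
       J k.+1 (set_reg r k.+1 o2)
       & budget emb2 (advance (f k) done1) ops1 slack1 credit2])
       o1 emb1 credit1) ->
  (forall o' emb' credit', framed rs o o' -> J n o' ->
     budget emb' (advance (flatten [seq f k | k <- iota 0 n]) done) ops slack
       credit' -> Q o' emb' credit') ->
  wp w (for_loop r 1 body) Q o emb credit.
Proof.
move=> lt_r r_rs rs1 o1 bud J0 step post.
pose I k o' e cr := [/\ framed rs o o', J k o' &
  budget e (advance (flatten [seq f k' | k' <- iota 0 k]) done)
    (flatten [seq f k' | k' <- iota k (n - k)] ++ ops)
    (slack + (D + 10) * (n - k)) cr].
have r1 : r != 1 by apply: contraNneq rs1 => <-.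
apply: (wp_for w r 1 body n I) => //.
- exact: width_gt0.
- exact: lt_word.
- by case: bud => k _; lia.
- split=> //; first by apply: framed_set_reg.
  by case: bud => k srv le_k; exists k; rewrite ?subn0 //; lia.
- move=> k o' e cr lt_k or o'1 [fr Jk [kk srv le_kk]].
  have nk : n - k = (n - k.+1).+1 by lia.
  rewrite nk /= -catA in srv le_kk.
  have bud1 : budget e (advance (flatten [seq f k' | k' <- iota 0 k]) done)
      (f k ++ (flatten [seq f k' | k' <- iota k.+1 (n - k.+1)] ++ ops))
      (slack + (D + 10) * (n - k.+1) + 10 + D) cr.
    by exists kk => //; lia.
  apply: wp_conseq (step k o' e _ _ cr lt_k fr or Jk bud1).
  move=> o2 e2 cr2 [fr2 or2 J2 [k2 srv2 le_k2]].
  have {bud1 le_kk} [le10 le_k2'] : 10 <= cr2 /\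
      k2 + (slack + (D + 10) * (n - k.+1)) <= cr2 - 10.
    by move: (_ * _) le_k2; lia.
  split=> //.
    by rewrite (proj1 fr2).
  split=> //; first exact: framed_set_reg.
  exists k2 => //.
  have -> : iota 0 k.+1 = iota 0 k ++ [:: k] by rewrite -addn1 iotaD.
  by move: srv2; rewrite -advance_cat map_cat flatten_cat /= cats0.
- move=> o' e cr o'1 [fr Jn [k srv le_k]]; apply: post => //.
  by exists k; [move: srv; rewrite subnn | lia].
Qed.

(** * The program for a single phase *)

Definition do_gadget (a l : nat) (b : bool) : com :=
  branch (etruth a 5 b) (Seq (do_update l) (do_update l.+1)) Skip.

Lemma usable_etruth a r b o j : a < 32 -> r < 8 -> reg o r = j -> j <= n ->
  (forall a i, arr o a i <= 1) -> usable w o (etruth a r b).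
Proof.
move=> lt_a lt_r oj lt_j bits; apply: usable_degree => //=.
- by rewrite lt_a lt_r.
- by case: b.
- by rewrite oj lt_pow20.
Qed.

Lemma wp_gadget a l b q j (v : nat -> bool) o emb done ops slack credit
    (Q : state -> state -> nat -> Prop) :
  a < 32 -> timed l -> timed l.+1 -> good_own q o -> reg o 5 = j -> j < n ->
  arr o a j = v j ->
  budget emb done ((if v j == b then gadget l q j else [::]) ++ ops)
    (slack + 50) credit ->
  (forall emb' credit',
     budget emb' (advance (if v j == b then gadget l q j else [::]) done) ops
       slack credit' -> Q o emb' credit') ->
  wp w (do_gadget a l b) Q o emb credit.
Proof.
move=> lt_a tl tl1 good o5 lt_j aj [k srv le_k] post.
have bits : forall a i, arr o a i <= 1 by case: good.
apply: wp_branch; [|by rewrite /=; lia|].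
  by apply: (usable_etruth _ _ _ _ j) => //; apply: ltnW.
have -> : expr_val o (etruth a 5 b) = (v j == b).
  by rewrite /= o5 aj; case: (v j); case: (b).
case: ifP srv post => /= vb srv post; rewrite ?eqb1 ?eqb0 ?vb /=.
  apply: wp_seq; apply: (wp_update l q j _ _ _ _ (slack + 20)) => //.
    by exists k; [exact: srv | rewrite /=; lia].
  move=> e1 c1 b1; apply: (wp_update l.+1 q j) => //.
    exact: b1.
  by move=> e2 c2 b2; apply: post.
apply: wp_skip; first by rewrite /=; lia.
by apply: post; exists k => //; rewrite /=; lia.
Qed.

Definition reads (u v t : nat -> bool) (o : state) : Prop :=
  forall j, j < n -> [/\ arr o 1 j = u j, arr o 2 j = v j & arr o 3 j = t j].

Lemma framed_good rs q o o' : 1 \notin rs -> 3 \notin rs ->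
  framed rs o o' -> good_own q o -> good_own q o'.
Proof.
by move=> h1 h3 [fr fa] [ o1 o3 lt_q bits]; split; rewrite ?fr ?fa.
Qed.

Lemma framed_reads rs u v t o o' :
  framed rs o o' -> reads u v t o -> reads u v t o'.
Proof. by move=> [_ fa] rd j lt_j; rewrite fa; apply: rd. Qed.

Definition do_sides (b : bool) : com :=
  for_loop 5 1 (Seq (do_gadget 2 3 b) (do_gadget 3 6 b)).

Lemma wp_sides b q u v t o emb done ops slack credit
    (Q : state -> state -> nat -> Prop) :
  good_own q o -> reads u v t o ->
  budget emb done (sides b n q v t ++ ops) (slack + (100 + 10) * n + 10)
    credit ->
  (forall o' emb' credit', framed [:: 5] o o' ->
     budget emb' (advance (sides b n q v t) done) ops slack credit' ->
     Q o' emb' credit') ->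
  wp w (do_sides b) Q o emb credit.
Proof.
move=> good rd bud post.
(* The 100 steps are two gadgets of 50, each consisting of a test and two updates of 20. *)
apply: (wp_for_ops 5 [:: 5] _ (side_step b q v t) (fun _ _ => True) 100 _ _ _
  _ _ _ _ _ _ _ _ bud) => //.
- by case: good.
- move=> k o1 e1 ops1 slack1 cr1 done1 lt_k fr o5 _ bud1.
  have good1 := framed_good [:: 5] _ _ _ isT isT fr good.
  have [_ a2 a3] := framed_reads _ _ _ _ _ _ fr rd k lt_k.
  apply: wp_seq; apply: (wp_gadget 2 3 b q k v _ _ _ _ (slack1 + 50)) => //.
    move: bud1; rewrite /side_step -catA => -[kk srv le_kk].
    by exists kk; [exact: srv | lia].
  move=> e2 c2 bud2; apply: (wp_gadget 3 6 b q k t) => //; first exact: bud2.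
  move=> e3 c3 bud3; split=> //.
  by rewrite /side_step advance_cat.
- by move=> o' e' c' fr _; apply: post.
Qed.

Definition do_end (m : dyn_mode) : com :=
  Seq (assign 5 (eidx m 4))
    (if is_inc m then
       branch (etruth 1 5 true)
         (Seq (do_update 1) (Seq (do_update 9) ask)) Skip
     else
       Seq (branch (etruth 1 5 true) ask Skip)
         (Seq (do_update 1) (do_update 9))).

Definition found (u v t : nat -> bool) (k : nat) : bool :=
  has (fun k' => u (idx m n k') && `[< triangle n A v t (idx m n k') >])
    (iota 0 k).

Lemma foundS u v t k : found u v t k.+1 =
  found u v t k || u (idx m n k) && `[< triangle n A v t (idx m n k) >].
Proof. by rewrite /found -addn1 iotaD has_cat /= orbF. Qed.

Lemma eval_eidx o r k : reg o 1 = n -> reg o r = k ->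
  expr_val o (eidx m r) = idx m n k.
Proof.
by move=> o1 or; rewrite /eidx /idx; case: is_inc; rewrite /= ?o1 or ?addn1.
Qed.

Lemma usable_eidx o r k : r < 8 -> reg o 1 = n -> reg o r = k -> k <= n ->
  (forall a i, arr o a i <= 1) -> usable w o (eidx m r).
Proof.
move=> lt_r o1 or le_k bits; apply: usable_degree => //.
- by rewrite /eidx; case: is_inc; rewrite /= ?lt_r.
- by rewrite /eidx; case: is_inc.
- by rewrite /eidx; case: is_inc.
- apply/allP => r'; rewrite mem_undup /eidx; case: is_inc; rewrite /= !inE.
    by case/orP=> /eqP ->; rewrite ?o1 ?or lt_pow20.
  by move/eqP ->; rewrite or lt_pow20.
Qed.

Lemma wp_ends p u v t o emb done0 ops slack credit
    (Q : state -> state -> nat -> Prop) :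
  let q := idx m n p in
  let done := advance (sides (is_inc m) n q v t) done0 in
  p < n -> history m n p done0 -> good_own q o -> reads u v t o ->
  reg o 6 = 0 ->
  budget emb done (ends m n q u n ++ ops) (slack + (120 + 10) * n + 10)
    credit ->
  (forall o' emb' credit', framed [:: 4; 5; 6; 7] o o' ->
     reg o' 6 = found u v t n ->
     budget emb' (advance (ends m n q u n) done) ops slack credit' ->
     Q o' emb' credit') ->
  wp w (for_loop 4 1 (do_end m)) Q o emb credit.
Proof.
move=> q done lt_p hist good rd o6 bud post.
pose J k o' := reg o' 6 = found u v t k.
(* The 120 steps cover the index, the test, two updates of 20 and a query of 50. *)
apply: (wp_for_ops 4 [:: 4; 5; 6; 7] _ (fun k => end_step m q u (idx m n k)) J
  120 _ _ _ _ _ _ _ _ _ _ _ bud) => //.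
- by case: good.
move=> k o1 e1 ops1 slack1 cr1 done1 lt_k fr o4 J1 bud1.
have good1 := framed_good [:: 4; 5; 6; 7] _ _ _ isT isT fr good.
have rd1 := framed_reads _ _ _ _ _ _ fr rd.
have [ o1n o13 lt_q bits] := good1.
have c1 : 100 < cr1 by case: bud1 => kk _; lia.
apply: wp_seq; apply: wp_assign => //.
- by apply: usable_eidx o1n o4 _ bits; lia.
- by rewrite /eidx; case: (is_inc m) => /=; lia.
have cE : cost (eidx m 4) <= 5 by rewrite /eidx; case: is_inc.
rewrite (eval_eidx _ _ k) //; set i := idx m n k.
set o2 := set_reg 5 i o1.
have lt_i : i < n by rewrite /i /idx; case: (is_inc m); lia.
have fr2 : framed [:: 4; 5; 6; 7] o o2 by apply: framed_set_reg.
have good2 := framed_good [:: 4; 5; 6; 7] _ _ _ isT isT fr2 good.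
have [a1 _ _] := framed_reads _ _ _ _ _ _ fr2 rd i lt_i.
have o25 : reg o2 5 = i by [].
have o26 : reg o2 6 = found u v t k by [].
have now : u i -> at_query n
    (present m (advance (sides (is_inc m) n q v t ++
       ends m n q u (k + is_inc m)) done0)) v t q i.
  exact: at_queryP.
have us1 : usable w o2 (etruth 1 5 true).
  have bits2 : forall a i, arr o2 a i <= 1 by case: good2.
  by apply: (usable_etruth _ _ _ _ i) => //; apply: ltnW.
have test : expr_val o2 (etruth 1 5 true) = u i.
  by rewrite /= a1; case: (u i).
have done1E : done1 = advance (sides (is_inc m) n q v t ++ ends m n q u k)
  done0.
  by rewrite advance_cat.
(* At an insertion query both ends of the current pair head the list of finished updates; by
   [done1E'], a deletion query sees only those of the earlier pairs. *)
have done2E : u i -> is_inc m -> advance (sides (is_inc m) n q v t ++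
    ends m n q u (k + is_inc m)) done0 = [:: (9, q, i), (1, q, i) & done1].
  move=> ui inc; have -> : k + is_inc m = k.+1 by rewrite inc addn1.
  have -> : ends m n q u k.+1 = ends m n q u k ++ end_step m q u i.
    by rewrite /ends -addn1 iotaD map_cat flatten_cat /= cats0.
  by rewrite catA advance_cat -done1E /end_step inc ui.
have done1E' : ~~ is_inc m -> advance (sides (is_inc m) n q v t ++
    ends m n q u (k + is_inc m)) done0 = done1.
  by move=> dec; rewrite done1E (negPf dec) addn0.
move: bud1; rewrite /end_step -/i.
case inc : (is_inc m) => /= bud1.
  apply: wp_branch; [exact: us1 | by rewrite /=; lia|].
  rewrite test; case ui : (u i) bud1 => /= bud1.
    case: bud1 => kk srv le_kk.
    apply: wp_seq; apply: (wp_update 1 q i _ _ _ _ (slack1 + 70)) => //.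
      by exists kk; [exact: srv | rewrite /=; lia].
    move=> e2 c2 bud2.
    apply: wp_seq; apply: (wp_update 9 q i _ _ _ _ (slack1 + 50)) => //.
      by case: bud2 => k2 srv2 le_k2; exists k2; [exact: srv2 | lia].
    move=> e3 c3 bud3.
    apply: (wp_ask q i (found u v t k) v t _ _
      [:: (9, q, i), (1, q, i) & done1] ops1 slack1) => //.
    + by move: (now ui); rewrite done2E.
    move=> o3 e4 c4 fr3 o36 bud4; split.
    + by apply: framed_trans fr2 _; apply: framed_sub fr3 => r; rewrite !inE;
        lia.
    + by rewrite (proj1 fr3).
    + by rewrite /J foundS ui.
    + exact: bud4.
  apply: wp_skip; first by lia.
  split=> //; first by rewrite /J foundS ui orbF.
  case: bud1 => kk srv le_kk; exists kk => //; lia.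
apply: wp_seq; apply: wp_branch; [exact: us1 | by rewrite /=; lia|].
(* In a deletion run the ends are removed after the test, whether or not [u] selects [i]; both
   branches share this tail. *)
have last e2 o3 c2 : framed [:: 6; 7] o2 o3 -> reg o3 6 = found u v t k.+1 ->
  budget e2 done1 [:: Some (1, q, i), Some (9, q, i) & ops1] (slack1 + 40) c2 ->
  wp w (Seq (do_update 1) (do_update 9))
  (fun o2 emb2 credit2 => [/\ framed [:: 4; 5; 6; 7] o o2, reg o2 4 = k,
       J k.+1 (set_reg 4 k.+1 o2)
       & budget emb2 (advance [:: Some (1, q, i); Some (9, q, i)] done1)
           ops1 slack1 credit2]) o3 e2 c2.
  move=> fr3 o36 [kk srv le_kk].
  have fr4 : framed [:: 4; 5; 6; 7] o o3.
    by apply: framed_trans fr2 _; apply: framed_sub fr3 => r; rewrite !inE; lia.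
  have good3 := framed_good [:: 4; 5; 6; 7] _ _ _ isT isT fr4 good.
  have o35 : reg o3 5 = i by rewrite (proj1 fr3).
  apply: wp_seq; apply: (wp_update 1 q i _ _ _ _ (slack1 + 20)) => //.
    by exists kk; [exact: srv | lia].
  move=> e3 c3 bud3; apply: (wp_update 9 q i _ _ _ ops1 slack1) => //.
    exact: bud3.
  move=> e4 c4 bud4; split=> //.
  by rewrite (proj1 fr3).
rewrite test; case ui : (u i) bud1 => /= bud1.
  apply: (wp_ask q i (found u v t k) v t _ _ done1 _ (slack1 + 40)) => //.
  + by move: (now ui); rewrite done1E' // inc.
  + by case: bud1 => kk srv le_kk; exists kk; [exact: srv | lia].
  move=> o3 e2 c2 fr3 o36 bud2; rewrite /= in bud2.
  by apply: last => //; rewrite foundS ui.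
apply: wp_skip; first by lia.
apply: last => //; first by rewrite foundS ui orbF.
by case: bud1 => kk srv le_kk; exists kk; [exact: srv | lia].
Qed.

Definition do_closing : com := if is_inc m then Skip else do_sides true.

Definition do_phase : com :=
  Seq (assign 3 (eidx m 2))
    (Seq (do_sides (is_inc m))
      (Seq (assign 6 (EC 0))
        (Seq (for_loop 4 1 (do_end m))
          (Seq do_closing
            (Seq (assign 2 (EO WAdd (ER 2) (EC 1))) (assign 0 (ER 6))))))).

(** The three loops are the sides, the ends and the closing, the last being charged in both
    modes. *)
Definition phase_cost : nat :=
  30 + ((100 + 10) * n + 10) + ((120 + 10) * n + 10) + ((100 + 10) * n + 10).

Lemma wp_phase p u v t o emb done ops slack credit :
  p < n -> history m n p done -> reg o 1 = n -> reg o 2 = p ->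
  (forall a i, arr o a i <= 1) -> reads u v t o ->
  budget emb done (phase m n p (u, v, t) ++ ops) (slack + phase_cost) credit ->
  wp w do_phase (fun o' emb' credit' =>
    [/\ reg o' 0 = found u v t n, reg o' 1 = n, reg o' 2 = p.+1, arr o' = arr o
      & budget emb' (advance (phase m n p (u, v, t)) done) ops slack credit'])
    o emb credit.
Proof.
move=> lt_p hist o1 o2 bits rd [k srv le_k].
rewrite /phase_cost in le_k.
have cE : cost (eidx m 2) <= 5 by rewrite /eidx; case: is_inc.
apply: wp_seq; apply: wp_assign => //.
- by apply: usable_eidx o1 o2 _ bits; apply: ltnW.
- by lia.
rewrite (eval_eidx _ _ p) //; set q := idx m n p; set oa := set_reg 3 q o.
have lt_q : q < n by rewrite /q /idx; case: (is_inc m); lia.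
have gooda : good_own q oa by split.
set cost3 := (100 + 10) * n + 10 in le_k.
set cost2 := (120 + 10) * n + 10 in le_k.
apply: wp_seq; apply: (wp_sides (is_inc m) q u v t _ _ done
    (ends m n q u n ++ closing m n q v t ++ ops)
    (slack + cost3 + cost2 + 20)) => //.
  exists k; first by move: srv; rewrite /phase -!catA.
  by move: le_k; rewrite /cost3; lia.
move=> ob eb cb frb [kb srvb le_kb].
apply: wp_seq; apply: wp_assign => //.
- by apply: usable_degree => // a i; rewrite (proj2 frb); apply: bits.
- by rewrite /=; lia.
have frc : framed [:: 5; 6] oa (set_reg 6 0 ob).
  by apply: framed_set_reg => //; apply: framed_sub frb => r;
    rewrite !inE => ->.
have goodc := framed_good [:: 5; 6] _ _ _ isT isT frc gooda.
have rdc : reads u v t (set_reg 6 0 ob).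
  by apply: framed_reads frc _ => j; apply: rd.
apply: wp_seq; apply: (wp_ends p u v t _ _ done (closing m n q v t ++ ops)
    (slack + cost3 + 10)) => //.
  by exists kb; [exact: srvb | move: le_kb; rewrite /cost2 /=; lia].
move=> od ed cd frd od6 budd.
have fr_d : framed [:: 4; 5; 6; 7] oa od.
  by apply: framed_trans frd; apply: framed_sub frc => r; rewrite !inE; lia.
have doneE : advance (phase m n p (u, v, t)) done =
    advance (closing m n q v t) (advance (ends m n q u n)
      (advance (sides (is_inc m) n q v t) done)).
  by rewrite /phase -/q !advance_cat.
apply: wp_seq.
(* The tail common to both modes: count the phase and move the answer from register 6 to register
   0. *)
have finish oe ee ce : framed [:: 4; 5; 7] od oe ->
    budget ee (advance (phase m n p (u, v, t)) done) ops (slack + 9) ce ->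
    wp w (Seq (assign 2 (EO WAdd (ER 2) (EC 1))) (assign 0 (ER 6)))
    (fun o' emb' credit' => [/\ reg o' 0 = found u v t n, reg o' 1 = n,
       reg o' 2 = p.+1, arr o' = arr o
     & budget emb' (advance (phase m n p (u, v, t)) done) ops slack credit'])
    oe ee ce.
  move=> fre [ke srve le_ke].
  have fr_e : framed [:: 4; 5; 6; 7] oa oe.
    by apply: framed_trans fr_d _; apply: framed_sub fre => r; rewrite !inE;
      lia.
  have oe1 : reg oe 1 = n by rewrite (proj1 fr_e).
  have oe2 : reg oe 2 = p by rewrite (proj1 fr_e).
  have oe6 : reg oe 6 = found u v t n by rewrite (proj1 fre).
  have arre : arr oe = arr o by rewrite (proj2 fr_e).
  have bitse a i : arr oe a i <= 1 by rewrite arre.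
  have le_p : p <= n by apply: ltnW.
  have us2 : usable w oe (EO WAdd (ER 2) (EC 1)).
    by apply: usable_degree => //=; rewrite oe2 lt_pow20.
  have us6 : usable w (set_reg 2 p.+1 oe) (ER 6).
    apply: usable_degree => //=; rewrite /override /= oe6 lt_pow20 //.
    by apply: leq_trans (leq_b1 _) _.
  apply: wp_seq; apply: wp_assign => //; first by rewrite /=; lia.
  rewrite [expr_val _ _]/= oe2 addn1.
  apply: wp_assign => //; first by rewrite /=; lia.
  split=> //.
  by exists ke => //; rewrite /=; lia.
rewrite /do_closing; rewrite /closing in budd doneE.
case inc : (is_inc m) budd doneE => budd doneE.
  have [kd srvd le_kd] := budd.
  apply: wp_skip; first by lia.
  apply: finish; first exact: framed_refl.
  by rewrite doneE; exists kd; [exact: srvd | lia].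
apply: (wp_sides true q u v t _ _ _ ops (slack + 9)).
- exact: framed_good [:: 4; 5; 6; 7] _ _ _ isT isT fr_d gooda.
- by apply: framed_reads fr_d _ => j; apply: rd.
- case: budd => kd srvd le_kd; exists kd; first exact: srvd.
  by move: le_kd; rewrite /cost3; lia.
move=> oe ee ce fre bude; apply: finish.
  by apply: framed_sub fre => r; rewrite !inE; lia.
by rewrite doneE.
Qed.

End Phase.

(** * From phases to complete runs *)

Definition coord (n : nat) (x : 'rV[bool]_n) (j : nat) : bool :=
  if insub j is Some j' then x ord0 j' else false.

Lemma coordE n (x : 'rV[bool]_n) (j : 'I_n) : coord n x j = x ord0 j.
Proof. by rewrite /coord valK. Qed.

Definition data_of (n : nat) (q : omv3_query n) : query_data :=
  let: (u, v, t) := q in (coord n u, coord n v, coord n t).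

Lemma reads_put n u v t o :
  reads n (coord n u) (coord n v) (coord n t) (omv3_put_query (u, v, t) o).
Proof.
move=> j lt_j; split; rewrite /= /override /=;
  by rewrite -[j]/(val (Ordinal lt_j)) valK coordE.
Qed.

Lemma bits_put n (q : omv3_query n) o : (forall a i, arr o a i <= 1) ->
  forall a i, arr (omv3_put_query q o) a i <= 1.
Proof.
case: q => [[u v] t] bits a i /=; rewrite /override.
by do 3?[case: eqP => _ /=; first by case: insub => [?|];
  rewrite ?leq_b1 //= /override /=].
Qed.

Lemma abs_put n (q : omv3_query n) St o emb :
  abs St o emb -> abs (omv3_put_query q St) (omv3_put_query q o) emb.
Proof.
case: q => [[u v] t] [hr ha [er ea]]; split=> //=.
move=> a lt_a i; rewrite /override.
do 3?[case: eqP => _ /=; first by case: insub => //=; rewrite /override /= ha].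
exact: ha.
Qed.

Lemma found_answer m n (A : nat -> nat -> bool) (M : 'M[bool]_n) (q :
  omv3_query n) :
  (forall i j : 'I_n, A i j = M i j) ->
  let: (u, v, t) := q in
  found m n A (coord n u) (coord n v) (coord n t) n = omv3_answer M q.
Proof.
case: q => [[u v] t] AM /=; rewrite /found.
apply/hasP/existsP => [[k]|[i /existsP[j /existsP[k /and5P[ui vj tk ij]]]]].
  rewrite mem_iota => lt_k /andP[+ /asboolP[j [k' [[lt_j lt_k' + +] [+ + +]]]]].
  have lt_i : idx m n k < n by rewrite /idx; case: (is_inc m); lia.
  rewrite -[idx m n k]/(val (Ordinal lt_i)) -[j]/(val (Ordinal lt_j)).
  rewrite -[k']/(val (Ordinal lt_k')) !coordE !AM => ui vj tk ij jk ki.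
  exists (Ordinal lt_i); apply/existsP; exists (Ordinal lt_j); apply/existsP.
  by exists (Ordinal lt_k'); rewrite ui vj tk ij jk ki.
move=> /andP[jk ki].
(* Every index below [n] is treated in one of the [n] rounds. *)
have := ltn_ord i; have := seenP m n n i (leqnn n).
have -> : seen m n n i by rewrite /seen; case: (is_inc m); have := ltn_ord i;
  lia.
move=> /mapP[k0 k0n iE] _; exists k0 => //; rewrite -iE coordE ui /=.
by apply/asboolP; exists j, k; rewrite !coordE !AM.
Qed.

(** The hosted run on the whole sequence is fixed in the proof only. The program [do_phase] reads
    just the current query and replays the matching section of that run, so answers are given
    online. *)
Lemma serve_all m n c w upd qry (n_gt0 : 0 < n) (N_gt0 : 0 < 24 * n)
    (A : nat -> nat -> bool)
    (M : 'M[bool]_n) (qs : seq (omv3_query n)) p St o emb done k :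
  wide n w -> word_size c (24 * n) <= w -> (forall i j : 'I_n, A i j = M i j) ->
  p + size qs <= n -> abs St o emb -> reg o 1 = n -> reg o 2 = p ->
  (forall a i, arr o a i <= 1) -> history m n p done ->
  serving m n c upd qry N_gt0 A emb done (phases m n p (map (data_of n) qs)) k
    ->
  exists2 k', omv3_serves w M (do_phase m upd qry) St qs k' &
    k' <= k + size qs * phase_cost n.
Proof.
move=> w_wide w_hosted AM.
elim: qs p St o emb done k => [|q qs IH] p St o emb done k le_p ab o1 o2 bits
  hist srv; first by exists 0.
have lt_p : p < n by move: le_p => /=; lia.
have := found_answer m n A M q AM.
move: (abs_put n q _ _ _ ab) (bits_put n q _ bits) (reads_put n) srv.
have r1 : reg (omv3_put_query q o) 1 = n by case: (q) => [[? ?] ?].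
have r2 : reg (omv3_put_query q o) 2 = p by case: (q) => [[? ?] ?].
case: q le_p r1 r2 => [[u v] t] le_p r1 r2 ab' bits' rd srv ans.
have bud : budget m n c upd qry N_gt0 A emb done
    (phase m n p (coord n u, coord n v, coord n t) ++
     phases m n p.+1 (map (data_of n) qs)) (0 + phase_cost n) (k + phase_cost
       n).
  by exists k; [exact: srv | lia].
have [St1 [k1 [e [e1 [c1 [x1 ab1 le1 [a0 a1 a2 aa [k2 srv2 le2]]]]]]]] :=
  wp_phase m n c w upd qry n_gt0 N_gt0 w_wide w_hosted A _ _ _ _ _ _ _ _ _ _
    lt_p hist r1 r2 bits' (rd u v t o) bud _ ab'.
have [k' srv' le'] : exists2 k', omv3_serves w M (do_phase m upd qry) St1 qs k'
    & k' <= k2 + size qs * phase_cost n.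
  apply: IH ab1 a1 a2 _ _ srv2; first by move: le_p => /=; lia.
    by move=> a i; rewrite aa.
  exact: history_phase.
exists (k1 + k'); last by rewrite /= mulSn; lia.
exists k1, St1, k'; split=> //.
by case: ab1 => h _ _; rewrite h // a0 ans.
Qed.

(** * Preprocessing *)

Definition eand : expr -> expr -> expr := EO WAnd.
(** A disjunction of truth values through a positive sum, as [WOr] is excluded by [bounded_op]. *)
Definition eor (e1 e2 : expr) : expr := EO WLt (EC 0) (EO WAdd e1 e2).
Definition eeq (e : expr) (k : nat) : expr := EO WEq e (EC k).
Definition elen (e : expr) : expr := EO WLt e (ER 1).
Definition ele (e1 e2 : expr) : expr := EO WLt e1 (EO WAdd e2 (EC 1)).

(* During the preprocessing, register 4 is a loop index, 6 holds the number of
   nodes and 5 its square. *)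
Definition elayer (b : bool) (l x y : expr) : expr :=
  let timed := eand (EC b) in
  let below e1 e2 := eand (eand (elen e1) (ele e1 e2))
                          (EO WLt e2 (EO WAdd e1 (ER 1))) in
  let both := eand (elen x) (elen y) in
  eor (eor (eor (eor (eor
    (eand (eeq l 0) (eand (eeq x 0) (elen y)))
    (eand (eor (eeq l 1) (eeq l 9)) (timed both)))
    (eand (eor (eor (eeq l 2) (eeq l 5)) (eeq l 8))
       (eand both (EA 0 (EO WAdd (EO WMul x (ER 1)) y)))))
    (eand (eor (eeq l 3) (eeq l 6)) (timed (below x y))))
    (eand (eor (eeq l 4) (eeq l 7)) (timed (below y x))))
    (eand (eeq l 10) (eand (elen x) (eeq y 0))).

Definition emod12 (x : expr) : expr := EO WMod x (EC 12).
Definition ediv12 (x : expr) : expr := EO WDiv x (EC 12).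

Definition eup (b : bool) (x y : expr) : expr :=
  eand (EO WEq (emod12 y) (EO WAdd (emod12 x) (EC 1)))
       (elayer b (emod12 x) (ediv12 x) (ediv12 y)).

Definition eedge (b : bool) : expr :=
  let x := EO WDiv (ER 4) (ER 6) in let y := EO WMod (ER 4) (ER 6) in
  eor (eup b x y) (eup b y x).

(** The case distinction of [offset] as a sum of products with layer indicators, of which at most
    one is nonzero. *)
Definition eweight : expr :=
  let l := emod12 (ER 4) in let a := ediv12 (ER 4) in
  let mul := EO WMul in let add := EO WAdd in
  add (add (add (add (mul (EC 16) (mul (ER 1) (ER 1)))
    (mul (add (eeq l 1) (eeq l 10)) (mul (ER 1) a)))
    (mul (add (eeq l 2) (eeq l 9)) a))
    (mul (add (add (add (eeq l 3) (eeq l 5)) (eeq l 6)) (eeq l 8))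
       (EO WSub (ER 1) a)))
    (mul (add (eeq l 4) (eeq l 7)) (mul (EC 2) a)).

Lemma eval_eand o e1 e2 (b1 b2 : bool) :
  expr_val o e1 = b1 -> expr_val o e2 = b2 ->
  expr_val o (eand e1 e2) = b1 && b2.
Proof. by move=> /= -> ->; rewrite land_bool. Qed.

Lemma eval_eor o e1 e2 (b1 b2 : bool) :
  expr_val o e1 = b1 -> expr_val o e2 = b2 ->
  expr_val o (eor e1 e2) = b1 || b2.
Proof. by move=> /= -> ->; case: b1; case: b2. Qed.

Lemma eval_elayer m o n (A : nat -> nat -> bool) b l x y : reg o 1 = n -> b =
  ~~ is_inc m ->
  (forall i j, arr o 0 (i * n + j) = A i j) ->
  expr_val o (elayer b l x y) =
  layer_edge n A (present m [::]) (expr_val o l) (expr_val o x) (expr_val o y).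
Proof.
move=> o1 bE arrA.
have andE (b1 b2 : bool) : Nat.land b1 b2 = b1 && b2 by exact: land_bool.
have orE (b1 b2 : bool) : (0 < b1 + b2) = b1 || b2 by case: b1; case: b2.
have presentE l' q j : present m [::] l' q j = b by rewrite bE /present;
  case: (is_inc m).
rewrite /= o1.
move: (expr_val o l) (expr_val o x) (expr_val o y) => L X Y.
rewrite arrA !(andE, orE).
rewrite !addn1 !ltnS.
do 11?[case: L => [|L]]; rewrite /= ?presentE ?orbF //; case: b {bE presentE};
  rewrite ?andbT ?andbF //= -?andbA ?andbT //.
Qed.

Lemma eval_eweight o n : reg o 1 = n ->
  expr_val o eweight = weight n (reg o 4).
Proof.
move=> o1; rewrite /weight /= o1.
move: (reg o 4 %% 12) (reg o 4 %/ 12) => l a.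
by do 11?[case: l => [|l]]; rewrite /= ?addn0 ?mul0n ?mul1n ?addn0 ?add0n.
Qed.

Lemma eval_eup m o n (A : nat -> nat -> bool) b x y : reg o 1 = n -> b = ~~
  is_inc m ->
  (forall i j, arr o 0 (i * n + j) = A i j) ->
  expr_val o (eup b x y) =
  up_edge n A (present m [::]) (expr_val o x) (expr_val o y).
Proof.
move=> o1 bE arrA; apply: eval_eand; last exact: eval_elayer o1 bE arrA.
by rewrite /= addn1.
Qed.

Definition all_nodes_edge (m : dyn_mode) (n : nat) (A : nat -> nat -> bool)
    (i : nat) : bool :=
  up_edge n A (present m [::]) (i %/ (24 * n)) (i %% (24 * n)) ||
  up_edge n A (present m [::]) (i %% (24 * n)) (i %/ (24 * n)).

Lemma eval_eedge m o n (A : nat -> nat -> bool) b :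
  reg o 1 = n -> reg o 6 = 24 * n -> b = ~~ is_inc m ->
  (forall i j, arr o 0 (i * n + j) = A i j) ->
  expr_val o (eedge b) = all_nodes_edge m n A (reg o 4).
Proof.
move=> o1 o6 bE arrA.
apply: eval_eor; rewrite (eval_eup m _ n A) //; [congr (nat_of_bool _)..];
  by rewrite /= o6.
Qed.

(** This accounts for the exponent 20 in [degree]: the loop over all pairs of nodes must stay below
    the bound even for [n = 1]. *)
Lemma square_pow20 n : 0 < n -> 24 * n * (24 * n) < n.+1 ^ 20.
Proof.
move=> n_gt0; rewrite (expnD _ 18 2) [_ ^ 2]expnS expn1.
have : 2 ^ 10 <= n.+1 ^ 18.
  by apply: (@leq_trans (2 ^ 18)); [rewrite leq_exp2l | rewrite leq_exp2r].
move: (n.+1 ^ 18) => X; rewrite (_ : 2 ^ 10 = 1024) // => le_X.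
apply: (@leq_trans (1024 * (n.+1 * n.+1))); first by lia.
by rewrite leq_mul2r le_X orbT.
Qed.

Section Preparation.

Variables (n w : nat).
Hypothesis n_gt0 : 0 < n.
Hypothesis w_wide : wide n w.

Definition prep_regs (o : state) : Prop :=
  [/\ reg o 1 = n, reg o 5 = 24 * n * (24 * n), reg o 6 = 24 * n
    & forall a i, arr o a i <= 1].

Lemma lt_word_square x : x <= 24 * n * (24 * n) -> x < 2 ^ w.
Proof.
move=> le; apply: leq_ltn_trans le _.
apply: leq_trans (square_pow20 _ n_gt0) _.
by apply: leq_trans (wideP _ _ w_wide); rewrite leq_exp2l.
Qed.

Lemma prep_usable o e k : prep_regs o -> reg o 4 = k ->
  k < 24 * n * (24 * n) -> wf_expr e -> max_degree e <= 100 ->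
  height e <= 23 -> {subset vars e <= [:: 1; 4; 6]} -> usable w o e.
Proof.
move=> [ o1 o5 o6 bits] o4 lt_k wf deg h vs.
apply: (usable_degree n w n_gt0 w_wide) => //; apply/allP => r.
have sq := square_pow20 _ n_gt0.
rewrite mem_undup => /vs; rewrite !inE => /or3P[] /eqP ->.
- by rewrite o1; exact: lt_pow20.
- by rewrite o4; exact: ltn_trans lt_k sq.
- rewrite o6; apply: leq_ltn_trans sq; rewrite leq_pmulr //; lia.
Qed.

Definition store_loop (a rb : nat) (e : expr) : com :=
  for_loop 4 rb (store_hosted a (ER 4) e).

Lemma wp_store_loop a rb e len (f : nat -> nat) o emb rest credit
    (Q : state -> state -> nat -> Prop) :
  rb < 8 -> rb != 4 -> reg o rb = len -> len <= 24 * n * (24 * n) ->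
  prep_regs o -> wf_expr e -> max_degree e <= 100 -> height e <= 23 ->
  {subset vars e <= [:: 1; 4; 6]} ->
  (forall k o1, framed [:: 4] o o1 -> reg o1 4 = k -> expr_val o1 e = f k) ->
  (cost e + 12) * len + 10 + rest <= credit ->
  (forall o' emb' credit', framed [:: 4] o o' -> rest <= credit' ->
     (forall r, reg emb' r = reg emb r) ->
     (forall a' i, arr emb' a' i =
        if (a' == a) && (i < len) then f i else arr emb a' i) ->
     Q o' emb' credit') ->
  wp w (store_loop a rb e) Q o emb credit.
Proof.
move=> lt_rb rb4 orb le_len regs wf deg h vs ef le_c post.
(* Storing costs [cost e + 2] and the loop control 10, hence [cost e + 12] per cell. *)
pose I k o' e' c := [/\ framed [:: 4] o o',
  (cost e + 12) * (len - k) + rest <= c, forall r, reg e' r = reg emb r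
  & forall a' i, arr e' a' i =
        if (a' == a) && (i < k) then f i else arr emb a' i].
apply: (wp_for w 4 rb _ len I) => //.
- by rewrite eq_sym.
- exact: width_gt0 n_gt0 w_wide.
- exact: lt_word_square.
- by move: (_ * len) le_c => X; lia.
- split=> //; first exact: framed_set_reg.
    by rewrite subn0; move: (_ * len) le_c => X; lia.
  by move=> a' i; rewrite ltn0 andbF.
- move=> k o1 e1 c1 lt_k o14 o1rb [fr le1 er ea].
  have regs1 : prep_regs o1.
    by case: regs => h1 h5 h6 hb; split; rewrite ?(proj1 fr) // (proj2 fr).
  have lt_k2 : k < 24 * n * (24 * n) by apply: leq_trans le_len.
  have us1 : usable w o1 (ER 4).
    by apply: (prep_usable _ _ k) => // r; rewrite !inE => /eqP ->.
  have us2 : usable w o1 e by apply: (prep_usable _ _ k).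
  have nk : len - k = (len - k.+1).+1 by lia.
  rewrite nk mulnS in le1.
  have {le1} le1 : (cost e + 12) + rest <= c1 /\
      (cost e + 12) * (len - k.+1) + rest <= c1 - (cost e + 12).
    by move: (_ * _) le1 => X; lia.
  apply: wp_store_hosted => //; first by rewrite /=; lia.
  rewrite (ef k) // [expr_val _ _]/= o14; split=> //.
  + by rewrite /=; lia.
  split.
  + exact: framed_set_reg.
  + by move: (_ * _) le1 => X; rewrite /=; lia.
  + by move=> r; rewrite /= er.
  + move=> a' i; have := ea a' i; rewrite /= /override.
    case: eqP => [->|_] //= ea1.
    case: eqP => [->|ne]; first by rewrite ltnSn.
    by rewrite ea1 [i < k.+1]ltnS [in RHS]leq_eqVlt (introF eqP ne).
- by move=> o' e' c orb' [fr le' er ea]; apply: post;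
    rewrite // subnn in le' *; lia.
Qed.

Definition do_prep (m : dyn_mode) (prep : com) : com :=
  Seq (assign 1 (ER 0))
  (Seq (assign 6 (EO WMul (EC 24) (ER 1)))
  (Seq (assign 5 (EO WMul (ER 6) (ER 6)))
  (Seq (store_loop 0 5 (eedge (~~ is_inc m)))
  (Seq (store_loop 1 6 eweight)
  (Seq (assign_hosted 2 (EC 11))
  (Seq (assign_hosted 1 (EC 0))
  (Seq (assign_hosted 0 (ER 6)) (hosted prep)))))))).

Definition prep_cost : nat :=
  (cost (eedge true) + 12) * (24 * n * (24 * n)) +
  (cost eweight + 12) * (24 * n) + 60.

Lemma state_ext st st' :
  (forall r, reg st r = reg st' r) -> (forall a i, arr st a i = arr st' a i) ->
  st = st'.
Proof.
case: st => rg ar; case: st' => rg' ar' /= hr ha.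
by congr State; [exact/funext | apply/funext => a; exact/funext].
Qed.

(** The solver's run starts in one definite state, so the hosted memory must agree with it
    everywhere, including the zeros beyond the input. *)
Lemma initE m A N_gt0 emb :
  reg emb 0 = 24 * n -> reg emb 1 = 0 -> reg emb 2 = 11 ->
  (forall r, 2 < r -> reg emb r = 0) ->
  (forall a i, arr emb a i =
     if (a == 1) && (i < 24 * n) then weight n i else
     if (a == 0) && (i < 24 * n * (24 * n)) then all_nodes_edge m n A i : nat
     else 0) ->
  emb = nwstSP_init (graph n A (present m [::]))
    (fun x : 'I_(24 * n) => weight n x)
    (vertex n N_gt0 0 0) (vertex n N_gt0 11 0).
Proof.
move=> e0 e1 e2 er ea; apply: state_ext => [r|a i].
  case: r => [|[|[|r]]] //=; last exact: er.
    by rewrite /override /= vertexE //; lia.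
  by rewrite /override /= vertexE //; lia.
rewrite ea /= /override; case: a => [|[|a]] //=.
  case: ifP => lt_i.
    have lt1 : i %/ (24 * n) < 24 * n by rewrite ltn_divLR.
    have lt2 : i %% (24 * n) < 24 * n by rewrite ltn_mod.
    by rewrite !insubT.
  by rewrite insubF // ltn_divLR.
by case: ifP => lt_i; [rewrite insubT | rewrite insubF].
Qed.

Lemma wp_prep m prep (A : nat -> nat -> bool) N_gt0 o emb k0 emb0 credit :
  reg o 0 = n -> reg o 2 = 0 -> (forall a i, arr o a i <= 1) ->
  (forall i j, arr o 0 (i * n + j) = A i j) ->
  (forall r, reg emb r = 0) -> (forall a i, arr emb a i = 0) ->
  exec w prep (nwstSP_init (graph n A (present m [::]))
    (fun x : 'I_(24 * n) => weight n x)
    (vertex n N_gt0 0 0) (vertex n N_gt0 11 0)) k0 emb0 ->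
  k0 + prep_cost <= credit ->
  wp w (do_prep m prep) (fun o' emb' _ =>
    [/\ reg o' 1 = n, reg o' 2 = 0, forall a i, arr o' a i <= 1
      & emb' = emb0]) o emb credit.
Proof.
move=> o0 o2 bits arrA er ea x0; rewrite /prep_cost.
set c1 := _ * (24 * n * (24 * n)); set c2 := _ * (24 * n) => le_c.
have sq := square_pow20 _ n_gt0.
have le_n : n <= n by [].
have us0 : usable w o (ER 0).
  by apply: (usable_degree n w n_gt0 w_wide) => //=; rewrite o0 lt_pow20.
apply: wp_seq; apply: wp_assign => //; first by rewrite /=; lia.
rewrite [expr_val _ _]/= o0; set oa := set_reg 1 n o.
have us1 : usable w oa (EO WMul (EC 24) (ER 1)).
  by apply: (usable_degree n w n_gt0 w_wide) => //=;
    rewrite /override /= lt_pow20.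
apply: wp_seq; apply: wp_assign => //; first by rewrite /=; lia.
rewrite [expr_val _ _]/=; set ob := set_reg 6 (24 * n) oa.
have us2 : usable w ob (EO WMul (ER 6) (ER 6)).
  apply: (usable_degree n w n_gt0 w_wide) => //=; rewrite /override /= andbT.
  by apply: leq_ltn_trans sq; rewrite leq_pmulr //; lia.
apply: wp_seq; apply: wp_assign => //; first by rewrite /=; lia.
rewrite [expr_val _ _]/=; set oc := set_reg 5 _ ob.
have regsc : prep_regs oc by split.
have costE : cost (eedge (~~ is_inc m)) = cost (eedge true).
  by case: (is_inc m).
apply: wp_seq; apply: (wp_store_loop 0 5 _ (24 * n * (24 * n))
    (fun i => all_nodes_edge m n A i) _ _ (k0 + c2 + 30)) => //.
- by case: (is_inc m).
- by apply/allP; case: (is_inc m).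
- move=> k o1 fr o14; rewrite -o14; apply: eval_eedge => //.
  + by rewrite (proj1 fr).
  + by rewrite (proj1 fr).
  + by move=> i j; rewrite (proj2 fr) -arrA.
- by rewrite costE -/c1 /=; lia.
move=> od ed cd frd le_cd erd ead.
have regsd : prep_regs od.
  by case: regsc => h1 h5 h6 hb; split; rewrite ?(proj1 frd) // (proj2 frd).
have odN : reg od 6 = 24 * n by case: regsd.
apply: wp_seq; apply: (wp_store_loop 1 6 _ (24 * n)
    (fun i => weight n i) _ _ (k0 + 20)) => //.
- by rewrite leq_pmulr //; lia.
- by apply/allP.
- by move=> k o1 fr o14; rewrite -o14; apply: eval_eweight; rewrite (proj1 fr);
    case: regsd.
- by rewrite -/c2; lia.
move=> oe ee ce fre le_ce ere eae.
have fr : framed [:: 4] oc oe by apply: framed_trans frd fre.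
have oe6 : reg oe 6 = 24 * n by rewrite (proj1 fr).
have bitse a i : arr oe a i <= 1 by rewrite (proj2 fr); apply: bits.
have usc k : k <= 100 -> usable w oe (EC k).
  by move=> le_k; apply: (usable_degree n w n_gt0 w_wide); rewrite //= maxn0.
have us6 : usable w oe (ER 6).
  apply: (usable_degree n w n_gt0 w_wide) => //=; rewrite oe6 andbT.
  by apply: leq_ltn_trans sq; rewrite leq_pmulr //; lia.
(* The sink is node 11 and the source node 0. *)
apply: wp_seq; apply: wp_assign_hosted; [exact: usc | by rewrite /=; lia |].
apply: wp_seq; apply: wp_assign_hosted; [exact: usc | by rewrite /=; lia |].
apply: wp_seq; apply: wp_assign_hosted; [exact: us6 | by rewrite /=; lia |].
set ef := set_reg 0 _ _.
have efE : ef = nwstSP_init (graph n A (present m [::]))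
    (fun x : 'I_(24 * n) => weight n x)
    (vertex n N_gt0 0 0) (vertex n N_gt0 11 0).
  apply: initE; rewrite ?/ef //=.
    by move=> r; case: r => [|[|[|r]]] // _; rewrite /override /= ere erd.
  by move=> a i; rewrite eae ead ea.
rewrite -efE in x0; apply: (wp_call _ _ _ _ _ _ _ _ x0).
  by rewrite /=; lia.
split=> //; by rewrite (proj1 fr).
Qed.

End Preparation.

(** * The reduction *)

Import Order.TTheory GRing.Theory Num.Theory.

(** The 100 matches the exponent in [wide]; the [6 * c] is there for [word_size_nodes]. *)
Lemma wide_word_size c n : wide n (word_size (6 * c + 100) n).
Proof.
constructor; rewrite /word_size.
have lt : n.+1 <= 2 ^ (trunc_log 2 n).+1 by exact: trunc_log_ltn.
apply: (@leq_trans ((2 ^ (trunc_log 2 n).+1) ^ 100));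
  first by rewrite leq_exp2r.
by rewrite -expnM leq_exp2l // mulnC leq_mul2r leq_addl orbT.
Qed.

(** From [24 <= 2 ^ 5] the bit length grows by at most 5, which is at most a factor of 6. *)
Lemma word_size_nodes c n : 0 < n ->
  word_size c (24 * n) <= word_size (6 * c + 100) n.
Proof.
move=> n_gt0; rewrite /word_size.
have le : trunc_log 2 (24 * n) <= trunc_log 2 n + 5.
  rewrite -ltnS -(@ltn_exp2l 2) //.
  apply: leq_ltn_trans (_ : 24 * n < _);
    first by rewrite trunc_logP // muln_gt0.
  have lt : n < 2 ^ (trunc_log 2 n).+1 by exact: trunc_log_ltn.
  rewrite -addSn expnD; move: (2 ^ _) lt => X lt.
  by rewrite (_ : 2 ^ 5 = 32) //; lia.
apply: (@leq_trans (c * ((trunc_log 2 n).+1 * 6))); first by rewrite leq_mul2l;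
  lia.
by move: (trunc_log 2 n) => L; nia.
Qed.

Lemma serves_size m w n wt s t upd qry e st (ops : seq (dyn_op n)) k :
  @nwstSP_serves m w n wt s t upd qry e st ops k -> size ops <= k.
Proof.
elim: ops e st k => [|[x y|] ops IH] e st k //=.
  by move=> [k1 [st1 [k2 [/exec_pos x1 /IH srv ->]]]]; lia.
by move=> [k1 [st1 [k2 [/exec_pos x1 _ /IH srv ->]]]]; lia.
Qed.

Lemma bits_init n (M : 'M[bool]_n) a i : arr (omv3_init M) a i <= 1.
Proof.
rewrite /= /override; case: eqP => // _.
by case: insub => // x; case: insub => // y; exact: leq_b1.
Qed.

(** Reading back from the initial array makes the equation with the array contents hold for all [i]
    and [j], also out of range, where [layer_edge] masks the value. *)
Definition entry (n : nat) (M : 'M[bool]_n) (i j : nat) : bool :=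
  arr (omv3_init M) 0 (i * n + j) != 0.

Lemma entryE n (M : 'M[bool]_n) (i j : 'I_n) : entry n M i j = M i j.
Proof.
have n_gt0 : 0 < n by apply: leq_trans (ltn_ord i).
rewrite /entry /= /override /= divnMDl // divn_small // addn0.
by rewrite modnMDl modn_small // !valK; case: (M i j).
Qed.

Section Reduction.

Variables (R : realType) (m : dyn_mode) (prep upd qry : com) (T : nat -> R).
Variables (c a b : nat).
Hypothesis solver : forall n : nat, 0 < n ->
  forall (e : rel 'I_n) (wt : 'I_n -> nat) (s t : 'I_n) (ops : seq (dyn_op n)),
    is_graph e -> (forall x, wt x <= n ^ 2) ->
    legal_ops m e ops -> few_queries ops ->
  exists k0 st0 k,
    [/\ exec (word_size c n) prep (nwstSP_init e wt s t) k0 st0,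
        k0 <= a * n ^ b,
        nwstSP_serves m (word_size c n) wt s t upd qry e st0 ops k
      & (k%:R <= T n)%R].

Lemma solver_phases n (N_gt0 : 0 < 24 * n) A ds : size ds <= n ->
  exists k0 st0 k,
    [/\ exec (word_size c (24 * n)) prep
          (nwstSP_init (graph n A (present m [::]))
            (fun x : 'I_(24 * n) => weight n x)
            (vertex n N_gt0 0 0) (vertex n N_gt0 11 0)) k0 st0,
        k0 <= a * (24 * n) ^ b,
        serving m n c upd qry N_gt0 A st0 [::] (phases m n 0 ds) k
      & (k%:R <= T (24 * n))%R].
Proof.
move=> le_ds; apply: solver => //.
- exact: graphP.
- by move=> x; apply: weight_bound.
- exact: legal_phases.
- exact: few_queries_phases.
Qed.

(** The solver is run on [n] phases selecting everything: at least [n * n] operations, each of at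
    least one step. *)
Lemma square_le_time n : 0 < n -> ((n * n)%:R <= T (24 * n))%R.
Proof.
move=> n_gt0; have N_gt0 : 0 < 24 * n by rewrite muln_gt0.
pose ds : seq query_data :=
  map (fun d : (nat -> bool) * (nat -> bool) => (xpredT, d.1, d.2))
    (nseq n (xpredT, xpredT)).
have size_ds : size ds = n by rewrite size_map size_nseq.
have [|_ [st0 [k [_ _ /serves_size size_k le_k]]]] :=
  solver_phases n N_gt0 (fun _ _ => true) ds; first by rewrite size_ds.
apply: le_trans le_k; rewrite ler_nat; apply: leq_trans size_k.
rewrite size_map; have := size_phases_all m n 0 (nseq n (xpredT, xpredT)).
by rewrite size_nseq.
Qed.

Lemma omv3_from_nwstSP n (M : 'M[bool]_n) (qs : seq (omv3_query n)) :
  0 < n -> size qs = n ->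
  exists k0 st0 k,
    [/\ exec (word_size (6 * c + 100) n) (do_prep m prep) (omv3_init M) k0 st0,
        k0 <= a * (24 * n) ^ b + prep_cost n,
        omv3_serves (word_size (6 * c + 100) n) M (do_phase m upd qry) st0 qs k
      & (k%:R <= T (24 * n) + (n * phase_cost n)%:R)%R].
Proof.
move=> n_gt0 size_qs; have N_gt0 : 0 < 24 * n by rewrite muln_gt0.
have w_wide := wide_word_size c n.
have w_hosted := word_size_nodes c n n_gt0.
have [|k0 [emb0 [k [x0 le_k0 srv le_k]]]] :=
  solver_phases n N_gt0 (entry n M) (map (data_of n) qs).
  by rewrite size_map size_qs.
have arrE i j : arr (omv3_init M) 0 (i * n + j) = entry n M i j.
  rewrite /entry; have := bits_init n M 0 (i * n + j).
  by case: (arr _ _ _) => [|[|?]].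
have ab : abs (omv3_init M) (omv3_init M) zero_state.
  by split=> //; split=> // r; rewrite /= /override.
have [St1 [k1 [ o1 [e1 [cr [x1 ab1 le1 [r1 r2 bits eE]]]]]]] :=
  wp_prep n _ n_gt0 w_wide m prep (entry n M) N_gt0 (omv3_init M) zero_state k0
    emb0 _
    erefl erefl (bits_init n M) arrE (fun=> erefl) (fun _ _ => erefl)
    (exec_widen _ _ _ _ _ _ w_hosted x0) (leqnn _) _ ab.
rewrite eE in ab1.
have [|k' srv' le_k'] := serve_all m n c _ upd qry n_gt0 N_gt0 (entry n M) M qs
  0
  _ _ _ [::] k w_wide w_hosted (entryE n M) _ ab1 r1 r2 bits (history0 m n) srv.
  by rewrite size_qs.
exists k1, St1, k'; split=> //; first by move: le1 le_k0; lia.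
rewrite size_qs in le_k'.
apply: le_trans (_ : (k + n * phase_cost n)%:R <= _)%R;
  first by rewrite ler_nat.
by rewrite natrD lerD2r.
Qed.

End Reduction.

Lemma nwstSP_solver_solves_omv3 (R : realType) m prep upd qry (C y : R) :
  solves_nwstSP m prep upd qry 2 (fun n => (C * n%:R `^ y)%R) ->
  exists C' : R, solves_omv3 (do_prep m prep) (do_phase m upd qry)
    (fun n => (C' * n%:R `^ y)%R).
Proof.
move=> [c [a [b solver]]].
(* [prep_cost n] is at most [P * n ^ 2], where 576 is the square of 24. *)
pose P := (cost (eedge true) + 12) * 576 + (cost eweight + 12) * 24 + 60.
(* One share is the hosted run. As [phase_cost n <= 410 * n], the overhead is at most
   [410 * (n * n)], hence at most 410 further shares by [square_le_time]. The power of 24 comes from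
   the number of nodes. *)
exists (411%:R * (C * 24%:R `^ y))%R.
exists (6 * c + 100), (a * 24 ^ b + P), (b + 2) => n n_gt0 M qs size_qs.
have [k0 [st0 [k [x0 le_k0 srv le_k]]]] :=
  omv3_from_nwstSP R m prep upd qry _ c a b solver n M qs n_gt0 size_qs.
exists k0, st0, k; split=> //.
- apply: leq_trans le_k0 _; rewrite mulnDl; apply: leq_add.
    rewrite expnMn mulnA leq_mul2l; apply/orP; right.
    by rewrite expnD leq_pmulr // expn_gt0 n_gt0.
  apply: (@leq_trans (P * n ^ 2)).
    rewrite /P /prep_cost expnS expn1.
    by move: (cost _) (cost _) => x1 x2; nia.
  by rewrite leq_mul2l; apply/orP; right;
    rewrite addnC expnD leq_pmulr // expn_gt0 n_gt0.
have sq := square_le_time R m prep upd qry _ c a b solver n n_gt0.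
apply: le_trans le_k _.
have -> : (411%:R * (C * 24%:R `^ y) * n%:R `^ y =
           411%:R * (C * (24 * n)%:R `^ y) :> R)%R.
  by rewrite natrM powRM ?ler0n // !mulrA.
apply: le_trans (_ : _ <= (C * (24 * n)%:R `^ y) + 410%:R * (n * n)%:R)%R _.
  rewrite lerD2l -natrM ler_nat /phase_cost; nia.
have split411 (x : R) : (411%:R * x = x + 410%:R * x)%R.
  by rewrite (natrD R 1 410) mulrDl mul1r.
rewrite split411 lerD2l; apply: ler_wpM2l; [exact: ler0n | exact: sq].
Qed.

Lemma OMv3_hard (R : realType) (m : dyn_mode) :
  OMv3_hypothesis R -> nwstSP_requires m (omega R + 1)%R.
Proof.
move=> hyp eps eps_gt0 [prep [upd [qry solver]]].
(* Degree 2 suffices by [weight_bound]. *)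
have [C solverC] := solver 2.
have [C' omv3] := nwstSP_solver_solves_omv3 _ _ _ _ _ _ _ solverC.
by apply: (hyp eps eps_gt0); exists (do_prep m prep), (do_phase m upd qry), C'.
Qed.

Local Open Scope ring_scope.

Theorem theorem3p6 (R : realType) :
  OMv3_hypothesis R ->
  nwstSP_requires Incremental (omega R + 1) /\
  nwstSP_requires Decremental (omega R + 1).
Proof. by move=> hyp; split; exact: OMv3_hard. Qed.
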